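(* Let $k\ge 0$ and $\varepsilon\in\{0,1,2\}$ be integers with $d=3k+\varepsilon\ge 1$. Put $$\ell=\tfrac{1}{2}(3k+5+2\varepsilon)k+1+\varepsilon,\qquad p=(k+1)\,\delta_{2,\varepsilon},$$ where $\delta_{2,\varepsilon}$ is the Kronecker symbol ($1$ if $\varepsilon=2$, $0$ otherwise). Let $Y=Y(\ell,p)\subset\mathbb{P}^3$ be the reduced subscheme consisting of $\ell$ general lines together with $p$ general points lying on one further line $L_0$, where $L_0$ is general with respect to the $\ell$ lines (the line $L_0$ itself is not part of $Y$). Then the restriction map $$H^0(\mathbb{P}^3,\mathcal{O}_{\mathbb{P}^3}(d))\longrightarrow H^0(Y,\mathcal{O}_{Y}(d))$$ is an isomorphism.
   Context: We work over an algebraically closed field (of characteristic zero). ''General'' means that the configuration lies in a suitable dense Zariski-open subset of the relevant parameter space (products of Grassmannians of lines, of points on a line, etc.). The numbers $\ell,p$ are chosen so that both sides of the restriction map have the same dimension $\binom{d+3}{3}$. *)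

(* Defs.v *)
From HB Require Import structures.
From mathcomp Require Import all_boot all_order all_algebra.
From mathcomp Require Import mpoly.
Set Implicit Arguments. Unset Strict Implicit. Unset Printing Implicit Defensive.
Import GRing.Theory.
Local Open Scope ring_scope.

(* Parameter index set for a configuration of l lines (each given by two
   spanning vectors of K^4), the line L0 (two spanning vectors) and p points
   on L0 (each given by homogeneous coordinates [s:t] w.r.t. the basis of L0). *)
Definition cfg_index (l p : nat) : finType :=
  ((('I_l * 'I_2 * 'I_4) + ('I_2 * 'I_4)) + ('I_p * 'I_2))%type.

Section Config.
Variables (K : fieldType) (l p : nat) (x : cfg_index l p -> K).

Definition line_vec (i : 'I_l) (j : 'I_2) : 'I_4 -> K :=
  fun c => x (inl (inl (i, j, c))).
Definition L0_vec (j : 'I_2) : 'I_4 -> K := fun c => x (inl (inr (j, c))).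
Definition pt (j : 'I_p) : 'I_4 -> K :=
  fun c => x (inr (j, 0)) * L0_vec 0 c + x (inr (j, 1)) * L0_vec 1 c.

Definition restr_line (u v : 'I_4 -> K) (F : {mpoly K[4]}) : {mpoly K[2]} :=
  F \mPo [tuple 'X_0 * (u i)%:MP + 'X_1 * (v i)%:MP | i < 4].

(* The restriction map H^0(P^3,O(d)) -> H^0(Y,O_Y(d))
     = (+)_{lines} H^0(O_L(d)) (+) (+)_{points} K
   (Y a disjoint union, H^0(O_L(d)) = binary forms of degree d, fibre at a point
   = K via evaluation at the chosen representative) is bijective. *)
Definition restriction_bijective (d : nat) : Prop :=
  forall (g : 'I_l -> {mpoly K[2]}) (c : 'I_p -> K),
    (forall i, g i \is d.-homog) ->
    exists! F : {mpoly K[4]},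
      [/\ F \is d.-homog,
          (forall i, restr_line (line_vec i 0) (line_vec i 1) F = g i) &
          (forall j, F.@[pt j] = c j)].
End Config.

(* "P holds for a general configuration": P holds on a nonempty Zariski open
   subset D(Q), Q a nonzero polynomial in the parameters. *)
Definition general_cfg (K : fieldType) (l p : nat)
    (P : (cfg_index l p -> K) -> Prop) : Prop :=
  exists Q : {mpoly K[#|cfg_index l p|]}, Q != 0 /\
    forall x : cfg_index l p -> K,
      Q.@[fun i => x (enum_val i)] != 0 -> P x.

(* Main.v *)
Require Import Defs.
From HB Require Import structures.
From mathcomp Require Import all_boot all_order all_algebra.
From mathcomp Require Import mpoly.
From mathcomp Require Import ring zify.
From Stdlib Require Import Classical FunctionalExtensionality.
Set Implicit Arguments. Unset Strict Implicit. Unset Printing Implicit Defensive.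
Import GRing.Theory VectorInternalTheory.
Local Open Scope ring_scope.

(** The proof is the Horace method of Hartshorne and Hirschowitz on the single
    quadric [Q : x0 x3 = x1 x2], parametrized by [nu (s, t) = (1, s, t, s t)].
    Both sides of the restriction map have the same dimension, so it is enough to
    find one configuration for which no nonzero form of degree [d] vanishes on it;
    all lines are taken to be chords of [Q], a chord being a ruling line when its
    ends share the coordinate [s].

    If some of the lines are rulings [s = const], the trace on [Q] of a form [F]
    vanishing on the configuration is divisible by their equations, and the
    quotient vanishes at the ends of the other chords. When these ends impose
    independent conditions, [F] is a multiple of [Q], and the cofactor has degree
    [d - 2] and vanishes on the other lines. Counting conditions, this reduces
    [d = 3k] to [3(k-1) + 1] with [2k + 1] rulings, and [d = 3k + 2] to [3k] with
    [2k + 2] rulings, the points being put on a further ruling.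

    For [d = 3k + 1] the numbers do not match, and two steps are needed. Let [2k]
    of the lines move towards lines that cross [k] other chords at both their ends
    on [Q]. In the limit, a form also has zero gradient at the [2k] crossing
    points, so its trace has [2k] double points, which makes the count on [Q]
    exact with [2k + 1] rulings. The cofactor, of degree [3k - 1], vanishes on the
    [k] chords, on the [2k] lines crossing them (the double points are lost), and
    on the other lines. Moving the [2k] crossing lines and one more line into the
    ruling of [Q], the crossing points no longer count on the trace, and the
    cofactor of the next step has degree [3(k-1)] and vanishes on general lines. *)

(** * Injectivity of polynomial families of linear systems *)

(** A right inverse [C] of the matrix at [x0] turns [\det (A *m C)] into a function with value 1 at
    [x0]. Wherever it does not vanish, the specialized matrix still has a right inverse. *)
Lemma row_free_open (K : fieldType) (R : comNzRingType) (T : Type)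
    (iota : {rmorphism K -> R}) (ev : T -> {rmorphism R -> K})
    (evK : forall x, cancel iota (ev x)) m n (A : 'M[R]_(m, n)) (x0 : T) :
  row_free (map_mx (ev x0) A) ->
  exists2 D : R, ev x0 D != 0 &
    forall x, ev x D != 0 -> row_free (map_mx (ev x) A).
Proof.
move=> fA; pose C := pinvmx (map_mx (ev x0) A).
have evC x : map_mx (ev x) (map_mx iota C) = C.
  by apply/matrixP=> i j; rewrite !mxE evK.
exists (\det (A *m map_mx iota C)).
  by rewrite -det_map_mx map_mxM evC mulmxVp // det1 oner_eq0.
move=> x; rewrite -det_map_mx map_mxM evC => nz.
have u : map_mx (ev x) A *m C \in unitmx by rewrite unitmxE unitfE.
apply/row_freeP; exists (C *m invmx (map_mx (ev x) A *m C)).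
by rewrite mulmxA mulmxV.
Qed.

(** Vanishing on a line is an infinite family of linear conditions, and a determinant needs finitely
    many of them. As long as the rank is below [n], some further condition raises it. *)
Lemma finite_subfamily (K : fieldType) (I : Type) n (f : I -> 'cV[K]_n) :
  (forall x : 'rV_n, (forall i, x *m f i = 0) -> x = 0) ->
  exists m (s : 'I_m -> I), row_free (\matrix_(i < n, j < m) f (s j) i 0).
Proof.
move=> inj_f.
suff [m [A [fA colA]]] : exists m (A : 'M[K]_(n, m)),
    row_free A /\ forall j, exists i, col j A = f i.
  have [s sE] := fin_all_exists colA; exists m, s.
  suff -> : \matrix_(i < n, j < m) f (s j) i 0 = A by [].
  by apply/matrixP=> i j; rewrite mxE -sE mxE.
suff H r : (r <= n)%N -> exists m (A : 'M[K]_(n, m)),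
    (r <= \rank A)%N /\ forall j, exists i, col j A = f i.
  have [m [A [rA cA]]] := H n (leqnn n); exists m, A; split=> //.
  by rewrite /row_free eqn_leq rank_leq_row.
elim: r => [_|r IHr ltrn]; first by exists 0%N, 0; split=> // -[].
have [m [A [rA cA]]] := IHr (ltnW ltrn).
have [lt|] := ltnP r (\rank A); first by exists m, A.
move=> leA; have rkA : \rank A = r by apply/eqP; rewrite eqn_leq leA.
have [x [nzx xA]] : exists x : 'rV_n, x != 0 /\ x *m A = 0.
  have : kermx A != 0.
    by rewrite -mxrank_eq0 mxrank_ker rkA subn_eq0 -ltnNge.
  move/rowV0Pn => [v vk nzv]; exists v; split=> //.
  by apply/sub_kermxP.
(* [x] kills all columns chosen so far, so a condition that [x] does not kill lies outside their
   span. *)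
have [i xi] : exists i, x *m f i <> 0.
  apply: not_all_ex_not => h; move/eqP: nzx; apply; exact: inj_f.
exists (m + 1)%N, (row_mx A (f i)); split; last first.
  move=> j; case: (splitP j) => [j' jE|j' jE].
    have -> : j = lshift 1 j' by apply/val_inj.
    by rewrite colKl.
  have -> : j = rshift m j' by apply/val_inj.
  by exists i; rewrite colKr; apply/matrixP=> a b; rewrite !mxE !ord1.
rewrite -rkA -(mxrank_tr A) -(mxrank_tr (row_mx _ _)) tr_row_mx.
have sub : (A^T <= col_mx A^T (f i)^T)%MS by rewrite -addsmxE addsmxSl.
rewrite ltn_neqAle mxrankS // andbT.
apply/negP=> /eqP rkE.
have /andP[_ sub2] : (A^T == col_mx A^T (f i)^T)%MS.
  by rewrite -(geq_leqif (mxrank_leqif_eq sub)) rkE.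
have : ((f i)^T <= A^T)%MS.
  by apply: submx_trans sub2; rewrite -addsmxE addsmxSr.
case/submxP=> w wE; apply: xi.
by rewrite -[f i]trmxK wE trmx_mul trmxK mulmxA xA mul0mx.
Qed.

Lemma linear_sumZ (K : fieldType) (V W : lmodType K) (f : V -> W)
    (I : finType) (a : I -> K) (v : I -> V) :
  linear f -> f (\sum_i a i *: v i) = \sum_i a i *: f (v i).
Proof.
move=> lf; have f0 : f 0 = 0.
  by have := lf (-1) 0 0; rewrite scaler0 addr0 scaleN1r addNr.
elim/big_rec2: _ => // i x y _ <-; exact: lf.
Qed.

(** In a basis of [V], finitely many conditions that suffice at [t0] form a matrix over [{poly K}]
    which is row free at [t0]; [row_free_open] then supplies [D]. *)
Lemma kernel_open (K : fieldType) (V : vectType K) (I : Type)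
    (phi : I -> V -> {poly K}) (t0 : K) :
  (forall i, linear (phi i)) ->
  (forall F, (forall i, (phi i F).[t0] = 0) -> F = 0) ->
  exists2 D : {poly K}, D != 0 &
    forall t, D.[t] != 0 ->
      forall F, (forall i, (phi i F).[t] = 0) -> F = 0.
Proof.
move=> lphi inj0; pose n := dim V.
pose b (j : 'I_n) : V := @r2v K V (delta_mx 0 j).
have phiE i F t : (phi i F).[t] = \sum_j v2r F 0 j * (phi i (b j)).[t].
  rewrite -{1}[F]v2rK {1}(row_sum_delta (v2r F)) linear_sum /=.
  under eq_bigr do rewrite linearZ /=.
  rewrite linear_sumZ // horner_sum; apply: eq_bigr => j _.
  by rewrite hornerZ.
pose f i : 'cV[K]_n := \col_j (phi i (b j)).[t0].
have [|m [s fs]] := @finite_subfamily K I n f.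
  move=> x hx; suff x0 : @r2v K V x = 0 by rewrite -[x](@r2vK K V) x0 linear0.
  apply: inj0 => i; rewrite phiE; have /matrixP/(_ 0 0) := hx i.
  rewrite !mxE => {2}<-; apply: eq_bigr => j _.
  by rewrite r2vK mxE.
pose A : 'M[{poly K}]_(n, m) := \matrix_(i, j) phi (s j) (b i).
have [||D nzD HD] := @row_free_open K {poly K} K polyC (@horner_eval K) _ _ _ A t0.
- by move=> x c; rewrite /= /horner_eval hornerC.
- congr (row_free _): fs; apply/matrixP=> i j; rewrite !mxE //.
exists D; first by apply: contraNneq nzD => ->; rewrite /= /horner_eval horner0.
move=> t nzt F hF; have /row_freeP[C AC] := HD t nzt.
apply/(can_inj v2rK); rewrite linear0 -[v2r F]mulmx1 -AC mulmxA.
suff -> : v2r F *m map_mx (horner_eval t) A = 0 by rewrite mul0mx.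
apply/matrixP=> i j; rewrite !mxE -[RHS](hF (s j)) phiE.
by apply: eq_bigr => l _; rewrite !mxE /horner_eval ord1.
Qed.

(** * Quaternary forms and the quadric *)

Lemma rmorph_mmap n (A B C : comNzRingType) (f : A -> B) (f' : A -> C)
    (g : {rmorphism B -> C}) (h : 'I_n -> B) (h' : 'I_n -> C) (p : {mpoly A[n]}) :
  (forall a, g (f a) = f' a) -> (forall i, g (h i) = h' i) ->
  g (mmap f h p) = mmap f' h' p.
Proof.
move=> ff hh; rewrite /mmap rmorph_sum /=; apply: eq_bigr => m _.
rewrite rmorphM ff /= /mmap1 rmorph_prod; congr (_ * _).
by apply: eq_bigr => i _; rewrite rmorphXn hh.
Qed.

Section Forms.
Variable K : fieldType.

Definition peval n (u : 'I_n -> {poly K}) (F : {mpoly K[n]}) : {poly K} :=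
  mmap polyC u F.

Lemma horner_peval n (u : 'I_n -> {poly K}) F t :
  (peval u F).[t] = F.@[fun i => (u i).[t]].
Proof.
rewrite -/(horner_eval t _); apply: rmorph_mmap => [a|i] //=.
by rewrite /horner_eval hornerC.
Qed.

Lemma peval_linear n (u : 'I_n -> {poly K}) : linear (peval u).
Proof.
move=> a F G; rewrite /peval -mul_polyC.
by rewrite mmapD mmapZ.
Qed.

(** The chain rule: it holds for constants and variables and is stable under products and sums. *)
Lemma deriv_peval n (u : 'I_n -> {poly K}) F :
  (peval u F)^`() = \sum_i peval u F^`M(i) * (u i)^`().
Proof.
pose CR G := (peval u G)^`() = \sum_i peval u G^`M(i) * (u i)^`().
have CRC c : CR c%:MP.
  rewrite /CR /peval mmapC derivC big1 // => i _.
  by rewrite mderivC mmap0 mul0r.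
have CRX j : CR 'X_j.
  rewrite /CR {1}/peval mmapX mmap1U (bigD1 j) //= big1 ?addr0.
    have UU : (U_(j) - U_(j) = 0)%MM by rewrite -{1}[U_(j)%MM]add0m addmK.
    by rewrite mderivX mnm1E eqxx scale1r /peval UU mmapX mmap11 mul1r.
  by move=> i /negPf ij; rewrite mderivX mnm1E eq_sym ij scale0r /peval mmap0 mul0r.
have CRM p q : CR p -> CR q -> CR (p * q).
  rewrite /CR => hp hq; rewrite /peval rmorphM /= -!/(peval _ _) derivM hp hq.
  rewrite mulr_suml mulr_sumr -big_split; apply: eq_bigr => i _ /=.
  rewrite mderivM /peval rmorphD !rmorphM /=; ring.
have CRD p q : CR p -> CR q -> CR (p + q).
  rewrite /CR => hp hq; rewrite /peval rmorphD /= -!/(peval _ _) derivD hp hq.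
  rewrite -big_split; apply: eq_bigr => i _ /=.
  by rewrite mderivD /peval rmorphD /= mulrDl.
have CRXm m : CR 'X_[m].
  rewrite mpolyXE_id; apply: big_ind => [|p q|i _]; [exact: CRC|exact: CRM|].
  elim: (m i) => [|k IH]; first by rewrite expr0; exact: CRC.
  by rewrite exprS; apply: CRM.
apply: (mpolyind (P := CR)); first by rewrite -[0]mpolyC0; exact: CRC.
move=> c m p _ _ hp; apply: CRD => //; rewrite -mul_mpolyC.
by apply: CRM.
Qed.

Hypothesis charK0 : [pchar K] =i pred0.

Lemma natr_inj : injective (fun i : nat => i%:R : K).
Proof.
have aux (i j : nat) : (i <= j)%N -> i%:R = j%:R :> K -> i = j.
  move=> ij /eqP; rewrite eq_sym -subr_eq0 -natrB //.
  by rewrite (proj1 (pcharf0P K) charK0) subn_eq0 => ji; apply/eqP; rewrite eqn_leq ij.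
move=> i j /= E; case/orP: (leq_total i j) => h; first exact: aux.
by apply/esym/aux.
Qed.

Lemma poly_nonroot (p : {poly K}) : p != 0 -> exists t, p.[t] != 0.
Proof.
move=> nz; pose rs : seq K := [seq i%:R | i <- iota 0 (size p)].
have urs : uniq rs by rewrite map_inj_uniq ?iota_uniq //; exact: natr_inj.
have [/(max_poly_roots nz)/(_ urs)|] := boolP (all (root p) rs).
  by rewrite size_map size_iota ltnn.
by case/allPn => t _ ht; exists t.
Qed.

Lemma exists_notin (s : seq K) : exists t, t \notin s.
Proof.
have [|t] := @poly_nonroot (\prod_(a <- s) ('X - a%:P)).
  by rewrite monic_neq0 // monic_prod_XsubC.
by rewrite -rootE root_prod_XsubC; exists t.
Qed.

Lemma exists_fresh (n : nat) (s : seq K) :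
  exists r : seq K, [/\ size r = n, uniq r & forall t, t \in r -> t \notin s].
Proof.
elim: n => [|n [r [sr ur hr]]]; first by exists [::].
have [t ht] := exists_notin (r ++ s); exists (t :: r); split=> /=.
- by rewrite sr.
- by rewrite ur andbT; move: ht; rewrite mem_cat negb_or => /andP[].
move=> x; rewrite inE => /orP[/eqP->|/hr//].
by move: ht; rewrite mem_cat negb_or => /andP[].
Qed.

Lemma poly_eq0_fun (p : {poly K}) : (forall t, p.[t] = 0) -> p = 0.
Proof.
move=> h; apply/eqP/negPn/negP => /poly_nonroot[t]; by rewrite h eqxx.
Qed.

Lemma roots_eq0 (R : idomainType) (p : {poly R}) (rs : seq R) :
  (size p <= size rs)%N -> uniq rs -> (forall x, x \in rs -> p.[x] = 0) -> p = 0.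
Proof.
move=> sp urs h; apply/eqP/negPn/negP => nz.
have := max_poly_roots nz (rs := rs); rewrite urs ltnNge sp.
by move=> H; suff: false by []; apply: H => //; apply/allP => x /h /eqP.
Qed.

Lemma bipoly_eq0_fun (g : {poly {poly K}}) :
  (forall s t, g.[s%:P].[t] = 0) -> g = 0.
Proof.
move=> h; pose rs := [seq (i%:R : K)%:P | i <- iota 0 (size g)].
apply: (@roots_eq0 _ _ rs).
- by rewrite size_map size_iota.
- by rewrite map_inj_uniq ?iota_uniq // => i j /polyC_inj /natr_inj.
by move=> x /mapP[i _ ->]; apply: poly_eq0_fun => t.
Qed.

(** The ring is left general: scalars give points of the quadric, polynomials give curves on it, and
    two indeterminates give its generic point. *)
Definition nu (R : comNzRingType) (s t : R) : 'I_4 -> R :=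
  fun i => [:: 1; s; t; s * t]`_i.

Definition quad : {mpoly K[4]} :=
  'X_(inord 0) * 'X_(inord 3) - 'X_(inord 1) * 'X_(inord 2).

(** The trace on the quadric. The outer indeterminate is [s] and the inner one [t], so that
    evaluating at [s%:P] restricts to a ruling line. *)
Definition pull (F : {mpoly K[4]}) : {poly {poly K}} :=
  mmap (polyC \o polyC) (nu 'X 'X%:P) F.

Lemma pull_eval F (s t : K) : (pull F).[s%:P].[t] = F.@[nu s t].
Proof.
rewrite -/(horner_eval s%:P _) -/(horner_eval t _).
rewrite /pull (@rmorph_mmap _ _ _ _ _ polyC _ _ (nu s%:P 'X)).
- apply: rmorph_mmap => [a|i] /=; first by rewrite /horner_eval hornerC.
  rewrite /nu /horner_eval; case: i => [[|[|[|[|//]]]] lt] /=;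
    by rewrite ?hornerM ?hornerC ?hornerX.
- by move=> a /=; rewrite /horner_eval hornerC.
- rewrite /nu; case=> [[|[|[|[|//]]]] lt] /=; rewrite /horner_eval;
    by rewrite ?hornerM ?hornerC ?hornerX.
Qed.

Lemma sum4 (R : nmodType) (f : 'I_4 -> R) :
  \sum_i f i = f (inord 0) + f (inord 1) + f (inord 2) + f (inord 3).
Proof.
rewrite !big_ord_recl big_ord0 addr0 !addrA.
by congr (f _ + f _ + f _ + f _); apply/val_inj; rewrite /= inordK.
Qed.

Lemma prod4 (R : comNzRingType) (f : 'I_4 -> R) :
  \prod_i f i = f (inord 0) * f (inord 1) * f (inord 2) * f (inord 3).
Proof.
rewrite !big_ord_recl big_ord0 mulr1 !mulrA.
by congr (f _ * f _ * f _ * f _); apply/val_inj; rewrite /= inordK.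
Qed.

Lemma mmap1_nu (R : comNzRingType) (s t : R) (m : 'X_{1..4}) :
  mmap1 (nu s t) m = s ^+ (m (inord 1) + m (inord 3)) * t ^+ (m (inord 2) + m (inord 3)).
Proof.
rewrite /mmap1 prod4 /nu !inordK //= expr1n mul1r exprMn !exprD; ring.
Qed.

Lemma mdeg4 (m : 'X_{1..4}) :
  mdeg m = (m (inord 0) + m (inord 1) + m (inord 2) + m (inord 3))%N.
Proof.
rewrite mdegE !big_ord_recl big_ord0 addn0 !addnA.
by congr (m _ + m _ + m _ + m _)%N; apply/val_inj; rewrite /= inordK.
Qed.

(** The bounds are on sizes, hence strict on degrees: these polynomials form a space of dimension
    [A * B]. *)
Definition bideg A B (g : {poly {poly K}}) :=
  (size g <= A)%N /\ forall i, (size (g`_i)%R <= B)%N.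

Lemma coef_pull F i j : (pull F)`_i`_j =
  \sum_(m <- msupp F) F@_m * ((i == m (inord 1) + m (inord 3))%N%:R *
                              (j == m (inord 2) + m (inord 3))%N%:R).
Proof.
rewrite /pull /mmap coef_sum coef_sum; apply: eq_bigr => m _.
rewrite mmap1_nu /= -rmorphXn /= mulrCA [_%:P * _]mulrC -rmorphM /=.
rewrite coefMC coefXn mulr_natl coefMn coefMC coefXn -mulr_natl; ring.
Qed.


Lemma bideg_pull d F : F \is d.-homog -> bideg d.+1 d.+1 (pull F).
Proof.
move=> hF; have aux i j : (d < i)%N || (d < j)%N -> (pull F)`_i`_j = 0.
  move=> hij; rewrite coef_pull big_seq big1 // => m /(dhomog_mf hF).
  rewrite /= mdeg4 => hm.
  case/orP: hij => h.
    by rewrite (_ : (i == _)%N = false) ?mul0r ?mulr0 //; lia.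
  by rewrite (_ : (j == _)%N = false) ?mulr0 //; lia.
split=> [|i]; apply/leq_sizeP => j hj.
  by apply/polyP => l; rewrite aux ?coef0 // hj.
by rewrite aux // hj orbT.
Qed.

(** A monomial of degree [d] not divisible by [x0 x3] is determined by its image: the two exponents
    and [d] give the difference of the exponents of [x0] and [x3], one of which is 0. Hence nothing
    cancels in the trace. *)
Lemma normal_eq0 d N :
  (forall m, m \in msupp N -> mdeg m = d /\ minn (m (inord 0)) (m (inord 3)) = 0%N) ->
  pull N = 0 -> N = 0.
Proof.
move=> hN p0; apply/mpolyP => m; rewrite mcoeff0.
have [hm|] := boolP (m \in msupp N); last exact: memN_msupp_eq0.
have := congr1 (fun p : {poly {poly K}} => p`_(m (inord 1) + m (inord 3))`_(m (inord 2) + m (inord 3))) p0.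
rewrite coef_pull !coef0 (bigD1_seq m) //= !eqxx !mulr1 big_seq_cond big1 ?addr0 //.
move=> m' /andP[/hN]; rewrite mdeg4 => -[d' n']; have := hN _ hm; rewrite mdeg4 => -[dm nm].
have [e1|_] := eqVneq (m (inord 1) + m (inord 3))%N (m' (inord 1) + m' (inord 3))%N; last by rewrite mul0r mulr0.
have [e2|_] := eqVneq (m (inord 2) + m (inord 3))%N (m' (inord 2) + m' (inord 3))%N; last by rewrite !mulr0.
case/eqP; apply/mnmP => i.
have [E0 E1 E2 E3] : [/\ m' (inord 0) = m (inord 0), m' (inord 1) = m (inord 1),
  m' (inord 2) = m (inord 2) & m' (inord 3) = m (inord 3)] by split; lia.
by rewrite -[i]inord_val; case: i => [[|[|[|[|//]]]] lt] /=.
Qed.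

Lemma quad_homog : quad \is 2.-homog.
Proof.
by rewrite /quad rpredB // -mpolyXD dhomogX /= mdegD !mdeg1.
Qed.

(** Replacing [x0 x3] by [x1 x2] as often as possible changes [F] by a multiple of the quadric. The
    normal form [N] that remains has zero trace, hence is zero. If [d < 2] nothing is replaced and
    [G] is 0, so the truncated [d - 2] is harmless. *)
Lemma quad_division d F : F \is d.-homog -> (forall s t, F.@[nu s t] = 0) ->
  exists2 G, G \is (d - 2).-homog & F = quad * G.
Proof.
move=> hF F0.
pose c (m : 'X_{1..4}) := minn (m (inord 0)) (m (inord 3)).
pose e03 : 'X_{1..4} := (U_(inord 0) + U_(inord 3))%MM.
pose e12 : 'X_{1..4} := (U_(inord 1) + U_(inord 2))%MM.
pose r (m : 'X_{1..4}) := (m - e03 *+ c m)%MM.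
have rK m : (r m + e03 *+ c m = m)%MM.
  rewrite submK //; apply/mnm_lepP => i; rewrite mulmnE mnmDE !mnm1E.
  rewrite -[i]inord_val; case: i => [[|[|[|[|//]]]] lt] /=;
  rewrite -!val_eqE /= !inordK //= /c; lia.
pose nf m := (r m + e12 *+ c m)%MM.
(* The cofactor in the factorization of a difference of two [c m]-th powers. *)
pose Q m : {mpoly K[4]} := 'X_[r m] * \sum_(i < c m) 'X_[e03] ^+ ((c m).-1 - i) * 'X_[e12] ^+ i.
have XE m : 'X_[m] = quad * Q m + 'X_[nf m] :> {mpoly K[4]}.
  rewrite -{1}(rK m) /nf !mpolyXD -!mpolyXn /Q mulrCA -[quad]/(_ - _) -!mpolyXD.
  by rewrite -/e03 -/e12 -subrXX mulrBr subrK.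
have QH m : mdeg m = d -> Q m \is (d - 2).-homog.
  move=> md; rewrite /Q; have [->|c0] := posnP (c m); first by rewrite big_ord0 mulr0 rpred0.
  have dr : (mdeg (r m) + 2 * c m = d)%N.
    by rewrite -md -{3}(rK m) mdegD mdegMn mdegD !mdeg1.
  rewrite (_ : d - 2 = mdeg (r m) + 2 * (c m).-1)%N; last lia.
  apply: dhomogM; first by rewrite dhomogX.
  apply: rpred_sum => i _.
  rewrite !mpolyXn -mpolyXD dhomogX /= mdegD !mdegMn !mdegD !mdeg1; apply/eqP.
  have := ltn_ord i; lia.
pose G := \sum_(m <- msupp F) F@_m *: Q m.
pose N := \sum_(m <- msupp F) F@_m *: 'X_[nf m] : {mpoly K[4]}.
have FE : F = quad * G + N.
  rewrite {1}[F]mpolyE mulr_sumr -big_split; apply: eq_bigr => m _ /=.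
  by rewrite {1}XE scalerDr -scalerAr.
exists G.
  by rewrite /G big_seq rpred_sum // => m /(dhomog_mf hF) /= md; rewrite rpredZ // QH.
suff N0 : N = 0 by rewrite {1}FE N0 addr0.
apply: (@normal_eq0 d).
  move=> m /msupp_sum_le /flatten_mapP[m'].
  rewrite mem_filter /= => m'F; move/msuppZ_le; rewrite msuppX inE => /eqP ->.
  have md := dhomog_mf hF m'F; rewrite /= in md; split.
    by rewrite -md -{2}(rK m') !mdegD !mdegMn !mdegD !mdeg1.
  rewrite /nf /r !mnmDE !mnmBE !mulmnE !mnmDE !mnm1E -!val_eqE /= !inordK //= /c; lia.
apply: bipoly_eq0_fun => s t; rewrite pull_eval.
have -> : N = F - quad * G by rewrite {1}FE addrC addKr.
rewrite mevalB mevalM F0 /quad mevalB !mevalM !mevalXU /nu !inordK //=; ring.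
Qed.

End Forms.

(** * Open sets of configurations *)

Section Configurations.
Variable K : fieldType.
Hypothesis charK0 : [pchar K] =i pred0.

Lemma nu_horner (s t : {poly K}) i x : (nu s t i).[x] = nu s.[x] t.[x] i.
Proof.
by rewrite /nu; case: i => [[|[|[|[|//]]]] lt] /=; rewrite ?hornerC ?hornerM.
Qed.

(* A ruling line of the quadric when [p.1 = q.1]. *)
Definition chord (p q : K * K) (a b : K) : 'I_4 -> K :=
  fun i => a * nu p.1 p.2 i + b * nu q.1 q.2 i.

Definition vanish_chord (p q : K * K) (F : {mpoly K[4]}) :=
  forall a b, F.@[chord p q a b] = 0.

Definition cfg := nat -> K * K.
Definition curve_at (g : nat -> {poly K} * {poly K}) (t : K) : cfg :=
  fun n => ((g n).1.[t], (g n).2.[t]).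

(* Zariski openness, tested along polynomial curves only: two nonempty open sets
   then meet on the segment joining a point of each. *)
Definition zopen (P : cfg -> Prop) := forall g t0, P (curve_at g t0) ->
  exists2 D : {poly K}, D != 0 & forall t, D.[t] != 0 -> P (curve_at g t).

Lemma zopen_and P Q : zopen P -> zopen Q -> zopen (fun c => P c /\ Q c).
Proof.
move=> oP oQ g t0 [/oP[D nzD HD] /oQ[E nzE HE]].
exists (D * E); first by rewrite mulf_neq0.
by move=> t; rewrite hornerM mulf_eq0 negb_or => /andP[/HD ? /HE ?].
Qed.

Lemma zopen_imply (b : bool) P : zopen P -> zopen (fun c => b -> P c).
Proof.
case: b => oP g t0 h; last by exists 1; rewrite ?oner_eq0.
by have [D nzD HD] := oP g t0 (h isT); exists D => // t /HD.
Qed.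

Lemma zopen_lt n (P : nat -> cfg -> Prop) : (forall i, zopen (P i)) ->
  zopen (fun c => forall i, (i < n)%N -> P i c).
Proof.
move=> oP; elim: n => [|n IH]; first by move=> g t0 _; exists 1; rewrite ?oner_eq0.
move=> g t0 h; have [|D nzD HD] := zopen_and IH (oP n) (g := g) (t0 := t0).
  by split=> [i lti|]; apply: h; rewrite // ltnS ltnW.
exists D => // t /HD[h1 h2] i; rewrite ltnS leq_eqVlt => /orP[/eqP->|/h1] //.
Qed.

Lemma zopen_meet P Q c0 c1 : zopen P -> zopen Q -> P c0 -> Q c1 ->
  exists c, P c /\ Q c.
Proof.
move=> oP oQ Pc Qc.
pose seg (a b : K) := a%:P + (b - a) *: 'X.
pose g n := (seg (c0 n).1 (c1 n).1, seg (c0 n).2 (c1 n).2).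
have segE a b t : (seg a b).[t] = a + (b - a) * t.
  by rewrite hornerD hornerC hornerZ hornerX.
have E0 : curve_at g 0 = c0.
  apply: functional_extensionality => n; rewrite /curve_at !segE !mulr0 !addr0.
  by case: (c0 n).
have E1 : curve_at g 1 = c1.
  apply: functional_extensionality => n; rewrite /curve_at !segE !mulr1 !subrKC.
  by case: (c1 n).
have [|D nzD HD] := oP g 0; first by rewrite E0.
have [|E nzE HE] := oQ g 1; first by rewrite E1.
have [|t] := poly_nonroot charK0 (p := D * E); first by rewrite mulf_neq0.
rewrite hornerM mulf_eq0 negb_or => /andP[/HD ? /HE ?].
by exists (curve_at g t).
Qed.

(** Separating both coordinates ensures that no chord between two of the points lies on the
    quadric. *)
Definition distinct n (c : cfg) := forall i, (i < n)%N -> forall j, (j < n)%N ->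
  i != j -> (c i).1 <> (c j).1 /\ (c i).2 <> (c j).2.

Lemma zopen_distinct n : zopen (distinct n).
Proof.
apply: zopen_lt => i; apply: zopen_lt => j; apply: zopen_imply; apply: zopen_and.
- move=> g t0 /eqP; rewrite -subr_eq0 -hornerN -hornerD => nz.
  exists ((g i).1 - (g j).1).
    by apply: contraNneq nz => ->; rewrite horner0.
  by move=> t; rewrite hornerD hornerN subr_eq0 => /eqP.
- move=> g t0 /eqP; rewrite -subr_eq0 -hornerN -hornerD => nz.
  exists ((g i).2 - (g j).2).
    by apply: contraNneq nz => ->; rewrite horner0.
  by move=> t; rewrite hornerD hornerN subr_eq0 => /eqP.
Qed.

Lemma distinct_natr n : distinct n (fun i => (i%:R, i%:R)).
Proof.
by move=> i _ j _ /eqP ij /=; split=> /(natr_inj charK0).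
Qed.

(** Vanishing on a chord is split into the conditions at its points, indexed by the coefficients [a]
    and [b]. Along a curve of configurations each of them is polynomial in the parameter, so
    [kernel_open] applies. *)
Lemma zopen_lines d (R : nat -> nat -> Prop) :
  zopen (fun c => forall F, F \is d.-homog ->
    (forall i j, R i j -> vanish_chord (c i) (c j) F) -> F = 0).
Proof.
move=> g t0 inj0.
pose I := ({ij : nat * nat | R ij.1 ij.2} * (K * K))%type.
pose u (i : I) l : {poly K} :=
  i.2.1%:P * nu (g (sval i.1).1).1 (g (sval i.1).1).2 l +
  i.2.2%:P * nu (g (sval i.1).2).1 (g (sval i.1).2).2 l.
pose phi (i : I) (F : dhomog 4 K d) := peval (u i) F.
have uE i t l : (u i l).[t] =
    chord (curve_at g t (sval i.1).1) (curve_at g t (sval i.1).2) i.2.1 i.2.2 l.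
  by rewrite /u hornerD !hornerM !hornerC !nu_horner.
have phiE i F t : (phi i F).[t] =
    (F : {mpoly K[4]}).@[chord (curve_at g t (sval i.1).1)
        (curve_at g t (sval i.1).2) i.2.1 i.2.2].
  by rewrite /phi horner_peval; apply: meval_eq => l; rewrite uE.
have [||D nzD HD] := @kernel_open K (dhomog 4 K d) I phi t0.
- by move=> i a F G; rewrite /phi -peval_linear.
- move=> F hF; apply/val_inj; apply: inj0; first exact: dhomog_is_dhomog.
  move=> i j Rij a b.
  by have := hF (exist (fun x : nat * nat => R x.1 x.2) (i, j) Rij, (a, b)); rewrite phiE.
exists D => // t nzt F hF h.
suff : DHomog hF = 0 by move/(congr1 val).
apply: HD nzt _ _ => -[[[i j] Rij] [a b]]; rewrite phiE; exact: h.
Qed.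

(** * Interpolation on the quadric by simple and double points *)

Definition double_at (g : {poly {poly K}}) (p : K * K) :=
  [/\ g.[p.1%:P].[p.2] = 0, g^`().[p.1%:P].[p.2] = 0 & (g.[p.1%:P])^`().[p.2] = 0].

Lemma horner_bideg A B g (s t : K) : bideg A B g ->
  g.[s%:P].[t] = \sum_(i < A) \sum_(j < B) g`_i`_j * (s ^+ i * t ^+ j).
Proof.
move=> [sA sB]; rewrite (horner_coef_wide _ sA) horner_sum; apply: eq_bigr => i _.
rewrite -rmorphXn /= hornerM hornerC (horner_coef_wide _ (sB i)) mulr_suml.
by apply: eq_bigr => j _; ring.
Qed.

Lemma horner_deriv_wide (R : comNzRingType) A (p : {poly R}) x :
  (size p <= A)%N -> p^`().[x] = \sum_(i < A) p`_i * (x ^+ i.-1 *+ i).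
Proof.
move=> sA; have E : p = \sum_(i < A) (p`_i)%:P * 'X^i.
  apply/polyP => j; rewrite coef_sum.
  under eq_bigr => l _ do rewrite coefCM coefXn.
  have [ltj|lej] := ltnP j A; last first.
    rewrite nth_default ?(leq_trans sA) // big1 // => l _.
    by rewrite gtn_eqF ?mulr0 // (leq_trans (ltn_ord l)).
  rewrite (bigD1 (Ordinal ltj)) //= eqxx mulr1 big1 ?addr0 // => l /negPf.
  by rewrite -val_eqE /= eq_sym => ->; rewrite mulr0.
rewrite {1}E raddf_sum /= horner_sum; apply: eq_bigr => i _.
by rewrite derivM derivC mul0r add0r derivXn hornerM hornerC hornerMn hornerXn.
Qed.

Lemma horner_derivl_bideg A B g (s t : K) : bideg A B g ->
  g^`().[s%:P].[t] =
  \sum_(i < A) \sum_(j < B) g`_i`_j * ((s ^+ i.-1 *+ i) * t ^+ j).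
Proof.
move=> [sA sB]; rewrite (horner_deriv_wide _ sA) horner_sum; apply: eq_bigr => i _.
rewrite -rmorphXn -rmorphMn /= hornerM hornerC (horner_coef_wide _ (sB i)) mulr_suml.
by apply: eq_bigr => j _; ring.
Qed.

Lemma horner_derivr_bideg A B g (s t : K) : bideg A B g ->
  (g.[s%:P])^`().[t] =
  \sum_(i < A) \sum_(j < B) g`_i`_j * (s ^+ i * (t ^+ j.-1 *+ j)).
Proof.
move=> [sA sB]; rewrite (horner_coef_wide _ sA) raddf_sum /= horner_sum.
apply: eq_bigr => i _.
rewrite -rmorphXn /= derivM derivC mulr0 addr0 hornerM hornerC.
rewrite (horner_deriv_wide _ (sB i)) mulr_suml.
by apply: eq_bigr => j _; ring.
Qed.

(* [S] lists the simple points, with coordinates taken from two members of the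
   configuration, and [D] the double points. *)
Definition unisolvent A B (S : nat -> nat -> Prop) (D : nat -> Prop) (c : cfg) :=
  forall g, bideg A B g ->
    (forall i j, S i j -> g.[(c i).1%:P].[(c j).2] = 0) ->
    (forall i, D i -> double_at g (c i)) -> g = 0.

(** Polynomials of bounded bidegree are encoded as matrices of coefficients, to get a vector space
    of finite dimension for [kernel_open]. *)
Lemma zopen_unisolvent A B S D : zopen (unisolvent A B S D).
Proof.
move=> g t0 inj0.
pose I := ({ij : nat * nat | S ij.1 ij.2} + {i : nat | D i} * 'I_3)%type.
(* At a double point the indices 0, 1, 2 stand for the value, the [s]-derivative and the
   [t]-derivative. *)
pose wl (i : I) (l : nat) : {poly K} := match i with
  | inl x => (g (sval x).1).1 ^+ l
  | inr (x, o) => let s := (g (sval x)).1 in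
    if val o == 1%N then s ^+ l.-1 *+ l else s ^+ l end.
pose wr (i : I) (l : nat) : {poly K} := match i with
  | inl x => (g (sval x).2).2 ^+ l
  | inr (x, o) => let s := (g (sval x)).2 in
    if val o == 2%N then s ^+ l.-1 *+ l else s ^+ l end.
pose phi i (M : 'M[K]_(A, B)) : {poly K} :=
  \sum_a \sum_b M a b *: (wl i a * wr i b).
have lphi i : linear (phi i).
  move=> a M N; rewrite /phi scaler_sumr -big_split; apply: eq_bigr => x _ /=.
  rewrite scaler_sumr -big_split; apply: eq_bigr => y _ /=.
  by rewrite !mxE scalerDl scalerA.
pose mat (f : {poly {poly K}}) : 'M[K]_(A, B) := \matrix_(a, b) f`_a`_b.
have phiE i f t : (phi i (mat f)).[t] =
    \sum_(a < A) \sum_(b < B) f`_a`_b * ((wl i a).[t] * (wr i b).[t]).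
  rewrite horner_sum; apply: eq_bigr => x _; rewrite horner_sum.
  by apply: eq_bigr => y _; rewrite hornerZ hornerM mxE.
have phiP t f : bideg A B f -> (forall i, (phi i (mat f)).[t] = 0) <->
    (forall i j, S i j -> f.[(curve_at g t i).1%:P].[(curve_at g t j).2] = 0) /\
    (forall i, D i -> double_at f (curve_at g t i)).
  move=> bf; split=> [h|[h1 h2]].
    split=> [i j Sij|i Di].
      have := h (inl (exist (fun x : nat * nat => S x.1 x.2) (i, j) Sij)).
      rewrite phiE => e; rewrite -[RHS]e (horner_bideg _ _ bf); apply: eq_bigr => a _.
      by apply: eq_bigr => b _; rewrite /= !horner_exp.
    pose x o : I := inr (exist D i Di, o); split.
    - have := h (x (inord 0)); rewrite phiE => e.
      rewrite -[RHS]e (horner_bideg _ _ bf).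
      apply: eq_bigr => a _; apply: eq_bigr => b _.
      by rewrite /= inordK //= !horner_exp.
    - have := h (x (inord 1)); rewrite phiE => e.
      rewrite -[RHS]e (horner_derivl_bideg _ _ bf).
      apply: eq_bigr => a _; apply: eq_bigr => b _.
      by rewrite /= inordK //= hornerMn !horner_exp.
    - have := h (x (inord 2)); rewrite phiE => e.
      rewrite -[RHS]e (horner_derivr_bideg _ _ bf).
      apply: eq_bigr => a _; apply: eq_bigr => b _.
      by rewrite /= inordK //= hornerMn !horner_exp.
  move=> [[[i j] Sij]|[[i Di] o]]; rewrite phiE.
    rewrite -[RHS](h1 i j Sij) (horner_bideg _ _ bf); apply: eq_bigr => a _.
    by apply: eq_bigr => b _; rewrite /= !horner_exp.
  have [e0 e1 e2] := h2 i Di; case: o => [[|[|[|//]]] lt].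
  - rewrite -[RHS]e0 (horner_bideg _ _ bf); apply: eq_bigr => a _.
    by apply: eq_bigr => b _; rewrite /= !horner_exp.
  - rewrite -[RHS]e1 (horner_derivl_bideg _ _ bf); apply: eq_bigr => a _.
    by apply: eq_bigr => b _; rewrite /= hornerMn !horner_exp.
  - rewrite -[RHS]e2 (horner_derivr_bideg _ _ bf); apply: eq_bigr => a _.
    by apply: eq_bigr => b _; rewrite /= hornerMn !horner_exp.
pose inv (M : 'M[K]_(A, B)) : {poly {poly K}} :=
  \poly_(a < A) \poly_(b < B) (if insub a is Some a' then
     if insub b is Some b' then M a' b' else 0 else 0).
have invK M : mat (inv M) = M.
  apply/matrixP => a b; rewrite mxE coef_poly ltn_ord coef_poly ltn_ord.
  by rewrite (valK a) (valK b).
have binv M : bideg A B (inv M).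
  split=> [|i]; first exact: size_poly.
  rewrite coef_poly; case: ifP => _; first exact: size_poly.
  by rewrite size_poly0.
have [|E nzE HE] := @kernel_open K 'M[K]_(A, B) I phi t0 lphi.
  move=> M; rewrite -{1}[M]invK => /(phiP _ _ (binv M)) [h1 h2].
  rewrite -[M]invK (inj0 _ (binv M) h1 h2).
  by apply/matrixP => a b; rewrite !mxE !coef0.
exists E => // t nzt f bf h1 h2.
have f0 : mat f = 0 by apply: HE nzt _ _; apply/phiP.
have [sA sB] := bf.
apply/polyP => a; apply/polyP => b; rewrite !coef0.
have [lta|lea] := ltnP a A; last by rewrite [f`_a]nth_default ?coef0 // (leq_trans sA).
have [ltb|leb] := ltnP b B; last by rewrite nth_default // (leq_trans (sB a)).
by have /matrixP/(_ (Ordinal lta) (Ordinal ltb)) := f0; rewrite !mxE.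
Qed.

End Configurations.

(** * Trace and residual *)

Section Horace.
Variable K : fieldType.
Hypothesis charK0 : [pchar K] =i pred0.

Lemma vanish_left (p q : K * K) F : vanish_chord p q F -> F.@[nu p.1 p.2] = 0.
Proof.
move=> h; rewrite -(h 1 0); apply: meval_eq => i.
by rewrite /chord mul1r mul0r addr0.
Qed.

Lemma vanish_right (p q : K * K) F : vanish_chord p q F -> F.@[nu q.1 q.2] = 0.
Proof.
move=> h; rewrite -(h 0 1); apply: meval_eq => i.
by rewrite /chord mul1r mul0r add0r.
Qed.

Lemma vanish_ruling (s t t' : K) F : t != t' ->
  vanish_chord (s, t) (s, t') F -> (pull F).[s%:P] = 0.
Proof.
move=> tt' h; apply: (poly_eq0_fun charK0) => x; rewrite pull_eval.
have nz : t' - t != 0 by rewrite subr_eq0 eq_sym.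
rewrite -(h ((t' - x) / (t' - t)) ((x - t) / (t' - t))); apply: meval_eq => i.
rewrite /chord /nu /=.
by case: i => [[|[|[|[|//]]]] lt] /=; field.
Qed.

Lemma meval_quad_chord p q (a b : K) :
  (quad K).@[chord p q a b] = a * b * ((p.1 - q.1) * (p.2 - q.2)).
Proof.
rewrite /quad mevalB !mevalM !mevalXU /chord /nu !inordK //=; ring.
Qed.

(** The quadric meets the chord only at its ends, so [G] vanishes elsewhere on the chord. The ends
    are reached by shifting both coefficients by a parameter and cancelling a nonzero polynomial
    factor. *)
Lemma vanish_residual (p q : K * K) (G : {mpoly K[4]}) : p.1 <> q.1 -> p.2 <> q.2 ->
  vanish_chord p q (quad K * G) -> vanish_chord p q G.
Proof.
move=> n1 n2 h a b.
pose u i : {poly K} := (a%:P + 'X) * (nu p.1 p.2 i)%:P + (b%:P + 'X) * (nu q.1 q.2 i)%:P.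
have uE t : (peval u G).[t] = G.@[chord p q (a + t) (b + t)].
  rewrite horner_peval; apply: meval_eq => i.
  by rewrite /u /chord !(hornerD, hornerM, hornerC, hornerX).
have z : (a%:P + 'X) * (b%:P + 'X) * peval u G = 0.
  apply: (poly_eq0_fun charK0) => t.
  have /eqP := h (a + t) (b + t); rewrite mevalM meval_quad_chord -uE => e.
  apply/eqP; move: e; rewrite !(hornerM, hornerD, hornerC, hornerX) !mulf_eq0 !subr_eq0.
  by move/eqP: n1 => /negPf ->; move/eqP: n2 => /negPf ->; rewrite !orbF.
have -> : G.@[chord p q a b] = (peval u G).[0] by rewrite uE !addr0.
have nzX (c : K) : c%:P + 'X != 0 by rewrite addrC -size_poly_eq0 size_XaddC.
move/eqP: z; rewrite !mulf_eq0 !(negPf (nzX _)) /= => /eqP ->.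
by rewrite horner0.
Qed.

(** Each coefficient of [g] is the next one of [f] plus [s] times the next one of [g]; descending
    from the top bounds the degree in [t]. *)
Lemma bideg_divX A B (f g : {poly {poly K}}) (s : K) :
  bideg A.+1 B f -> f = g * ('X - s%:P%:P) -> bideg A B g.
Proof.
move=> [sA sB] fE; have cE i : g`_i = f`_i.+1 + s%:P * g`_i.+1.
  by rewrite fE mulrBr coefB coefMX coefMC /= mulrC subrK.
split.
  have [->|nz] := eqVneq g 0; first by rewrite size_poly0.
  move: sA; rewrite fE size_Mmonic ?monicXsubC // size_XsubC; lia.
suff H n i : (size g <= i + n)%N -> (size (g`_i)%R <= B)%N.
  by move=> i; apply: (H (size g)); rewrite leq_addl.
elim: n i => [|n IH] i; first by rewrite addn0 => h; rewrite nth_default // size_poly0.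
move=> h; rewrite cE; apply: leq_trans (size_polyD _ _) _.
rewrite geq_max sB /= mul_polyC; apply: leq_trans (size_scale_leq _ _) _.
by apply: IH; rewrite addSnnS.
Qed.

Lemma factor_rulings A B (rs : seq K) (f : {poly {poly K}}) :
  bideg (size rs + A) B f -> uniq rs -> (forall s, s \in rs -> f.[s%:P] = 0) ->
  exists2 g, bideg A B g & f = g * \prod_(s <- rs) ('X - s%:P%:P).
Proof.
elim: rs f => [|s rs IH] f bf /=; first by exists f; rewrite // big_nil mulr1.
case/andP=> sr ur h.
have /factor_theorem[f' f'E] : root f s%:P by rewrite /root h ?mem_head.
have [|g bg gE] := IH f' (bideg_divX bf f'E) ur.
  move=> x xr; have := h x; rewrite inE xr orbT => /(_ isT).
  rewrite f'E hornerM hornerXsubC => /eqP; rewrite mulf_eq0 subr_eq0.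
  case/orP=> [/eqP //|/eqP/polyC_inj xs]; by rewrite -xs xr in sr.
by exists g => //; rewrite f'E gE big_cons -mulrA [X in _ * X]mulrC.
Qed.

Lemma prod_rulings_horner (rs : seq K) (s : K) :
  (\prod_(x <- rs) ('X - x%:P%:P)).[s%:P] = (\prod_(x <- rs) (s - x))%:P.
Proof.
rewrite horner_prod rmorph_prod; apply: eq_bigr => x _.
by rewrite hornerXsubC rmorphB.
Qed.

Lemma prod_sub_neq0 (rs : seq K) (s : K) : s \notin rs ->
  \prod_(x <- rs) (s - x) != 0.
Proof.
move=> h; rewrite prodf_seq_neq0; apply/allP => x xr /=.
by rewrite subr_eq0; apply: contraNneq h => ->.
Qed.

Lemma factor_simple (rs : seq K) (g : {poly {poly K}}) (s t : K) : s \notin rs ->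
  (g * \prod_(x <- rs) ('X - x%:P%:P)).[s%:P].[t] = 0 -> g.[s%:P].[t] = 0.
Proof.
move=> h; rewrite hornerM prod_rulings_horner hornerM hornerC => /eqP.
by rewrite mulf_eq0 (negPf (prod_sub_neq0 h)) orbF => /eqP.
Qed.

Lemma factor_double (rs : seq K) (g : {poly {poly K}}) (p : K * K) : p.1 \notin rs ->
  double_at (g * \prod_(x <- rs) ('X - x%:P%:P)) p -> double_at g p.
Proof.
move=> h [/(factor_simple h) e0]; rewrite derivM hornerD hornerD !hornerM.
rewrite prod_rulings_horner hornerC e0 mul0r addr0.
move=> e1; rewrite derivM derivC mulr0 addr0 hornerM hornerC => e2.
have nz := prod_sub_neq0 h; split=> //.
  by move/eqP: e1; rewrite mulf_eq0 (negPf nz) orbF => /eqP.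
by move/eqP: e2; rewrite mulf_eq0 (negPf nz) orbF => /eqP.
Qed.

(** The conditions imposed by the lines span the dual of the space of forms of degree [d]. *)
Definition spanning d (L : seq ((K * K) * (K * K))) :=
  forall F, F \is d.-homog ->
    (forall l, l \in L -> vanish_chord l.1 l.2 F) -> F = 0.

Definition has_spanning d n := exists2 L, size L = n & spanning d L.

(** All end points are listed in one sequence, chord [m] taking the entries [2 m] and [2 m + 1], so
    that the same configuration carries the chords and their trace points. *)
Definition standard n i j := exists2 m, (m < n)%N & i = (2 * m)%N /\ j = (2 * m).+1.

Definition standard_spanning d n (c : cfg K) := forall F, F \is d.-homog ->
  (forall i j, standard n i j -> vanish_chord (c i) (c j) F) -> F = 0.

Lemma has_spanning_standard d n : has_spanning d n ->
  exists c, standard_spanning d n c.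
Proof.
move=> [L sL hL]; pose z : (K * K) * (K * K) := ((0, 0), (0, 0)).
exists (fun i => if odd i then (nth z L i./2).2 else (nth z L i./2).1).
move=> F hF h; apply: hL => // l /(nthP z)[m ltm <-].
have := h (2 * m)%N (2 * m).+1; rewrite mul2n /= odd_double /= doubleK uphalf_double.
by apply; exists m; rewrite -?sL // mul2n.
Qed.

(** Castelnuovo's residual sequence for the quadric: once the rulings are divided out of the trace,
    if the quotient is zero then so is the trace, and the quadric divides [F]. *)
Lemma castelnuovo d A (rs : seq K) F :
  F \is d.-homog -> (size rs + A = d.+1)%N -> uniq rs ->
  (forall s, s \in rs -> (pull F).[s%:P] = 0) ->
  (forall g, bideg A d.+1 g -> pull F = g * \prod_(x <- rs) ('X - x%:P%:P) -> g = 0) ->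
  exists2 G, G \is (d - 2).-homog & F = quad K * G.
Proof.
move=> hF sA ur hr hg; apply: (quad_division charK0) => // s t.
have [|g bg gE] := @factor_rulings A d.+1 rs (pull F) _ ur hr.
  by rewrite sA; exact: bideg_pull.
by rewrite -pull_eval gE (hg g) // mul0r !horner0.
Qed.

Lemma size_horner_bideg A B (g : {poly {poly K}}) (s : K) :
  bideg A B g -> (size g.[s%:P] <= B)%N.
Proof.
move=> [sA sB]; rewrite (horner_coef_wide _ sA).
apply: (big_ind (fun p : {poly K} => (size p <= B)%N)).
- by rewrite size_poly0.
- by move=> p q hp hq; apply: leq_trans (size_polyD _ _) _; rewrite geq_max hp.
move=> i _; rewrite -rmorphXn /= mulrC mul_polyC.
exact: leq_trans (size_scale_leq _ _) _.
Qed.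

Lemma grid_eq0 A B (g : {poly {poly K}}) : bideg A B g ->
  (forall a b, (a < A)%N -> (b < B)%N -> g.[(a%:R : K)%:P].[b%:R] = 0) -> g = 0.
Proof.
move=> bg h; pose rs := [seq (i%:R : K)%:P | i <- iota 0 A].
apply: (@roots_eq0 _ _ rs).
- by rewrite size_map size_iota; case: bg.
- by rewrite map_inj_uniq ?iota_uniq // => i j /polyC_inj /(natr_inj charK0).
move=> x /mapP[a]; rewrite mem_iota add0n => /andP[_ lta] ->.
apply: (@roots_eq0 _ _ [seq i%:R | i <- iota 0 B]).
- by rewrite size_map size_iota; exact: size_horner_bideg bg.
- by rewrite map_inj_uniq ?iota_uniq //; exact: natr_inj.
by move=> y /mapP[b]; rewrite mem_iota add0n => /andP[_ ltb] ->; exact: h.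
Qed.

(** The product has a simple zero along the ruling, so the [s]-derivative there is [g] times a
    nonzero constant: splitting off a ruling leaves a simple point of each double point on it. *)
Lemma factor_deriv (rs : seq K) (g : {poly {poly K}}) (s t : K) :
  uniq rs -> s \in rs ->
  (g * \prod_(x <- rs) ('X - x%:P%:P))^`().[s%:P].[t] = 0 -> g.[s%:P].[t] = 0.
Proof.
move=> urs srs; rewrite (big_rem s) //= mulrA [g * _]mulrC -mulrA derivM derivXsubC mul1r.
rewrite hornerD [X in _ + X]hornerM hornerXsubC subrr mul0r addr0; apply: factor_simple.
by rewrite mem_rem_uniqF.
Qed.

End Horace.

(** * Horace steps *)

Section Steps.
Variable K : fieldType.
Hypothesis charK0 : [pchar K] =i pred0.

Definition ruling_lines (rs : seq K) : seq ((K * K) * (K * K)) :=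
  [seq ((s, 0), (s, 1)) | s <- rs].

Lemma vanish_ruling_lines (rs : seq K) F :
  (forall l, l \in ruling_lines rs -> vanish_chord l.1 l.2 F) ->
  forall s, s \in rs -> (pull F).[s%:P] = 0.
Proof.
move=> h s sr; apply: (@vanish_ruling _ charK0 s 0 1); first by rewrite eq_sym oner_eq0.
by apply: (h ((s, 0), (s, 1))); apply/mapP; exists s.
Qed.

Definition standard_lines n (c : cfg K) : seq ((K * K) * (K * K)) :=
  mkseq (fun m => (c (2 * m)%N, c (2 * m).+1)) n.

Lemma vanish_standard_lines n c F :
  (forall l, l \in standard_lines n c -> vanish_chord l.1 l.2 F) ->
  forall i j, standard n i j -> vanish_chord (c i) (c j) F.
Proof.
move=> h i j [m ltm [-> ->]]; apply: (h (c (2 * m)%N, c (2 * m).+1)).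
by apply/mapP; exists m; rewrite // mem_iota.
Qed.

Lemma residual_standard n c G : distinct (2 * n) c ->
  (forall i j, standard n i j -> vanish_chord (c i) (c j) (quad K * G)) ->
  forall i j, standard n i j -> vanish_chord (c i) (c j) G.
Proof.
move=> dc h i j st; have [m ltm [iE jE]] := st.
have [n1 n2] : (c i).1 <> (c j).1 /\ (c i).2 <> (c j).2 by apply: dc; lia.
by apply: vanish_residual => //; exact: h.
Qed.

(** One Horace step from degree [d] to [d + 2] with [a] new rulings. The quotient of the trace lives
    in dimension [A * (d + 3)], matched by the [2 n] chord ends and the [p] points; the latter share
    one ruling, which bears at most [d + 3] independent conditions. *)
Lemma horace_points d n a A p : has_spanning K d n ->
  (A * (d + 3) = 2 * n + p)%N -> (p <= d + 3)%N -> (a + A = d + 3)%N ->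
  exists L (s0 : K) ts, [/\ size L = (n + a)%N, size ts = p &
    forall F, F \is (d + 2).-homog ->
      (forall l, l \in L -> vanish_chord l.1 l.2 F) ->
      (forall t, t \in ts -> F.@[nu s0 t] = 0) -> F = 0].
Proof.
move=> /has_spanning_standard[c0 hc0] cnt lep aA; set B := (d + 3)%N in cnt lep aA.
(* The extra points take their first coordinate from entry [2 n] and their second from entry [j],
   which puts them on one ruling. *)
pose S i j := (i = j /\ i < 2 * n)%N \/ (i = 2 * n /\ 2 * n <= j < 2 * n + p)%N.
(* The model is the full [A] by [B] grid: its first [p] cells, in the row [s = 0], are the extra
   points, and the other cells are the chord ends. *)
pose grid i : K * K := ((i %/ B)%N%:R, (i %% B)%N%:R).
pose c1 i := if (i < 2 * n)%N then grid (i + p)%N else (0, (i - 2 * n)%N%:R).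
have uc1 : unisolvent A B S (fun _ => False) c1.
  move=> g bg h _; apply: (grid_eq0 charK0 bg) => x y ltx lty.
  pose e := (x * B + y)%N.
  have lte : (e < 2 * n + p)%N.
    rewrite -cnt; apply: (@leq_trans (x.+1 * B)); first by rewrite /e mulSn; lia.
    by rewrite leq_mul2r ltx orbT.
  have B0 : (0 < B)%N by rewrite /B; lia.
  have [ep|pe] := ltnP e p.
    have x0 : x = 0%N by case: (x) @e ep {lte} => // x' /=; rewrite mulSn; lia.
    have := h (2 * n)%N (2 * n + e)%N; rewrite /c1 ltnn ltnNge leq_addr /= addKn.
    rewrite /e x0 mul0n add0n; apply; right; split=> //.
    by rewrite leq_addr ltn_add2l; move: ep; rewrite /e x0.
  have lti : (e - p < 2 * n)%N by lia.
  have := h (e - p)%N (e - p)%N; rewrite /c1 lti subnK // /grid /=.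
  rewrite /e divnMDl // divn_small // addn0 modnMDl modn_small //.
  by apply; left.
have o1 := @zopen_lines K d (standard n).
have o2 := @zopen_unisolvent K A B S (fun _ => False).
have [c' [h1 h2]] := zopen_meet charK0 o1 o2 hc0 uc1.
have [c [[hc uc] dc]] := zopen_meet charK0 (zopen_and o1 o2)
  (@zopen_distinct K (2 * n)) (conj h1 h2) (@distinct_natr K charK0 (2 * n)).
(* The new rulings avoid all trace points, so dividing by their equations preserves the vanishing
   there. *)
have [rs [srs urs frs]] := exists_fresh charK0 a [seq (c i).1 | i <- iota 0 (2 * n).+1].
have nrs i : (i <= 2 * n)%N -> (c i).1 \notin rs.
  move=> lei; apply/negP => /frs/negP; apply; apply/mapP; exists i => //.
  by rewrite mem_iota.
exists (standard_lines n c ++ ruling_lines rs), (c (2 * n)%N).1,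
  [seq (c (2 * n + j)%N).2 | j <- iota 0 p].
split.
- by rewrite size_cat size_mkseq size_map srs.
- by rewrite size_map size_iota.
move=> F hF hL hp.
have hS : forall i j, standard n i j -> vanish_chord (c i) (c j) F.
  by apply: vanish_standard_lines => l hl; apply: hL; rewrite mem_cat hl.
have [|||G hG FE] := castelnuovo charK0 (A := A) hF _ urs.
- by rewrite srs; lia.
- by apply: vanish_ruling_lines => l hl; apply: hL; rewrite mem_cat hl orbT.
- move=> g; rewrite (_ : (d + 2).+1 = B); last by rewrite /B; lia.
  move=> bg gE; apply: uc => // i j [[-> ltj]|[-> /andP[lej ltj]]].
  + apply: (@factor_simple _ rs); first by apply: nrs; exact: ltnW.
    rewrite -gE pull_eval; have jE := odd_double_half j.
    have st : standard n (2 * j./2)%N (2 * j./2).+1 by exists j./2 => //; lia.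
    case: (odd j) jE => jE.
      have -> : j = (2 * j./2).+1 by lia.
      exact: vanish_right (hS _ _ st).
    have -> : j = (2 * j./2)%N by lia.
    exact: vanish_left (hS _ _ st).
  + apply: (@factor_simple _ rs); first exact: nrs.
    rewrite -gE pull_eval; apply: hp; apply/mapP; exists (j - 2 * n)%N.
      by rewrite mem_iota; lia.
    by rewrite subnKC.
suff G0 : G = 0 by rewrite FE G0 mulr0.
apply: hc; first by move: hG; rewrite addnK.
by apply: residual_standard => // i j st; rewrite -FE; exact: hS.
Qed.

Lemma horace_lines d n a A : has_spanning K d n ->
  (A * (d + 3) = 2 * n)%N -> (a + A = d + 3)%N -> has_spanning K (d + 2) (n + a).
Proof.
move=> hn cnt aA; rewrite -[(2 * n)%N]addn0 in cnt.
have [L [s0 [ts [sL /size0nil tsE hL]]]] := horace_points hn cnt (leq0n _) aA.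
by exists L => // F hF h; apply: hL => // t; rewrite tsE.
Qed.


(* Besides the [k + r] standard chords there are [2 k] further ones, joining
   [c i], [i < 2 k], to the point [c (2 (k + r) + i)]: they cross the first [k]
   standard chords at both ends. *)
Definition mid_rel k r i j :=
  standard (k + r) i j \/ ((i < 2 * k)%N /\ j = (2 * (k + r) + i)%N).

Definition mid_spanning d k r (c : cfg K) := forall F, F \is d.-homog ->
  (forall i j, mid_rel k r i j -> vanish_chord (c i) (c j) F) -> F = 0.

(** The [2 (k + 1)] crossing chords and one standard chord are put into the ruling. The ends of the
    first [k + 1] chords then lie on these rulings and impose nothing on the quotient; the other
    [2 r] ends match its dimension [k * (3 k + 3)]. *)
Lemma mid_exists k r : (2 * r = 3 * k * k.+1)%N -> has_spanning K (3 * k) (k.+1 + r) ->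
  exists c, mid_spanning (3 * k + 2) k.+1 r.+1 c.
Proof.
move=> cnt /has_spanning_standard[c0 hc0].
pose n := (k.+1 + r)%N; pose B := (3 * k + 3)%N.
pose S i j := (i = j /\ 2 * k.+1 <= i < 2 * n)%N.
(* Only the entries from [2 (k + 1)] on have to fill the grid; truncated subtraction sends the
   earlier ones to the origin. *)
pose c1 i : K * K := (((i - 2 * k.+1) %/ B)%N%:R, ((i - 2 * k.+1) %% B)%N%:R).
have uc1 : unisolvent k B S (fun _ => False) c1.
  move=> g bg h _; apply: (grid_eq0 charK0 bg) => x y ltx lty.
  have B0 : (0 < B)%N by rewrite /B; lia.
  have lte : (x * B + y < k * B)%N.
    apply: (@leq_trans (x.+1 * B)); first by rewrite mulSn; lia.
    by rewrite leq_mul2r ltx orbT.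
  have := h (2 * k.+1 + (x * B + y))%N (2 * k.+1 + (x * B + y))%N.
  rewrite /c1 addKn /= divnMDl // divn_small // addn0 modnMDl modn_small //.
  apply; split=> //; rewrite leq_addr /= /n mulnDr ltn_add2l cnt.
  by apply: leq_trans lte _; rewrite /B; nia.
have o1 := @zopen_lines K (3 * k) (standard n).
have o2 := @zopen_unisolvent K k B S (fun _ => False).
have [c' [h1 h2]] := zopen_meet charK0 o1 o2 hc0 uc1.
have [c [[hc uc] dc]] := zopen_meet charK0 (zopen_and o1 o2)
  (@zopen_distinct K (2 * n)) (conj h1 h2) (@distinct_natr K charK0 (2 * n)).
have [s0 hs0] := exists_notin charK0 [seq (c i).1 | i <- iota 0 (2 * n)].
have ns0 i : (i < 2 * n)%N -> (c i).1 != s0.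
  move=> lti; apply: contraNneq hs0 => <-; apply/mapP; exists i => //.
  by rewrite mem_iota.
pose rs := s0 :: [seq (c i).1 | i <- iota 0 (2 * k.+1)].
have ltn' : (2 * k.+1 <= 2 * n)%N by rewrite /n; lia.
have urs : uniq rs.
  rewrite cons_uniq; apply/andP; split.
    apply/negP => /mapP[i]; rewrite mem_iota => /andP[_ lti] E.
    by have /eqP := ns0 i (leq_trans lti ltn'); rewrite E.
  rewrite map_inj_in_uniq ?iota_uniq // => i j; rewrite !mem_iota => /andP[_ lti] /andP[_ ltj] E; apply/eqP/negPn/negP.
  by move=> ij; have [] := dc i (leq_trans lti ltn') j (leq_trans ltj ltn') ij.
(* The old chords come first, then two points spanning the ruling [s0], then the far ends of the
   crossing chords, each on the ruling through its starting point. *)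
pose cc i : K * K := if (i < 2 * n)%N then c i
  else if (i < 2 * n + 2)%N then (s0, (i - 2 * n)%N%:R)
  else ((c (i - (2 * n + 2))%N).1, (c (i - (2 * n + 2))%N).2 + 1).
exists cc => F hF hv.
have hS i j : standard n i j -> vanish_chord (c i) (c j) F.
  move=> [m ltm [-> ->]]; have := hv (2 * m)%N (2 * m).+1.
  rewrite /cc !ifT; [|lia|lia]; apply; left; exists m => //.
  by move: ltm; rewrite /n; lia.
have [|||G hG FE] := castelnuovo charK0 (A := k) hF _ urs.
- have -> : size rs = (2 * k.+1).+1 by rewrite /rs -cat1s size_cat size_map size_iota.
  lia.
- move=> s; rewrite inE => /orP[/eqP ->|/mapP[i]].
    apply: (@vanish_ruling _ charK0 _ 0 1); first by rewrite eq_sym oner_eq0.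
    have E0 : cc (2 * n)%N = (s0, 0) by rewrite /cc ltnn subnn ifT //; lia.
    have E1 : cc (2 * n).+1 = (s0, 1).
      by rewrite /cc ifF ?subSnn ?ifT //; lia.
    by rewrite -E0 -E1; apply: hv; left; exists n => //; rewrite /n; lia.
  rewrite mem_iota => /andP[_ lti] ->.
  apply: (@vanish_ruling _ charK0 _ (c i).2 ((c i).2 + 1)).
    by rewrite -subr_eq0 opprD addNKr oppr_eq0 oner_eq0.
  have := hv i (2 * (k.+1 + r.+1) + i)%N.
  have E : (2 * (k.+1 + r.+1) = 2 * n + 2)%N by rewrite /n; lia.
  rewrite E /cc ifT; last exact: leq_trans lti ltn'.
  rewrite ifF; last lia. rewrite ifF; last lia.
  rewrite addKn; case: (c i) => x y /=; apply; right; split=> //; lia.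
- move=> g; rewrite (_ : (3 * k + 2).+1 = B); last by rewrite /B; lia.
  move=> bg gE; apply: uc => // i j [<- /andP[lei lti]].
  apply: (@factor_simple _ rs).
    rewrite inE negb_or ns0 //; apply/mapP => -[j']; rewrite mem_iota => /andP[_ ltj] E.
    have /eqP ij : i <> j' by lia.
    by have [] := dc i lti j' (leq_trans ltj ltn') ij.
  rewrite -gE pull_eval; have iE := odd_double_half i.
  have st : standard n (2 * i./2)%N (2 * i./2).+1 by exists i./2 => //; lia.
  case: (odd i) iE => iE.
    have -> : i = (2 * i./2).+1 by lia.
    exact: vanish_right (hS _ _ st).
  have -> : i = (2 * i./2)%N by lia.
  exact: vanish_left (hS _ _ st).
suff G0 : G = 0 by rewrite FE G0 mulr0.
apply: hc; first by move: hG; rewrite addnK.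
by apply: residual_standard => // i j st; rewrite -FE; exact: hS.
Qed.

End Steps.

(** * Crossing lines and double points *)

(* A condition [phi] that holds on the kernels [T t] for [t != 0] survives as a
   condition on their limit at [t = 0], even if it is not implied by [T 0]. *)
Lemma kernel_limit (K : fieldType) (charK0 : [pchar K] =i pred0) (V : vectType K)
    (T : K -> V -> Prop) :
  (forall F, (forall phi : V -> {poly K}, linear phi ->
     (forall t G, t != 0 -> T t G -> (phi G).[t] = 0) -> (phi F).[0] = 0) -> F = 0) ->
  exists t, forall F, T t F -> F = 0.
Proof.
move=> h; pose I := {phi : V -> {poly K} | linear phi /\
  forall t G, t != 0 -> T t G -> (phi G).[t] = 0}.
have [||D nzD HD] := @kernel_open K V I (fun i => sval i) 0.
- by move=> [phi [lphi hphi]].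
- move=> F hF; apply: h => phi lphi hphi.
  exact: (hF (exist _ phi (conj lphi hphi))).
have [|t] := poly_nonroot charK0 (p := D * 'X); first by rewrite mulf_neq0 ?polyX_eq0.
rewrite hornerM hornerX mulf_eq0 negb_or => /andP[Dt nzt].
by exists t => F TF; apply: (HD t Dt) => -[phi [lphi hphi]]; apply: hphi.
Qed.

Section Crossing.
Variable K : fieldType.
Hypothesis charK0 : [pchar K] =i pred0.

Definition grad (F : {mpoly K[4]}) (p : K * K) (i : nat) : K :=
  (F^`M(inord i)).@[nu p.1 p.2].

Lemma vanish_chord_sym (p q : K * K) F : vanish_chord p q F -> vanish_chord q p F.
Proof.
move=> h a b; rewrite -(h b a); apply: meval_eq => i; exact: addrC.
Qed.

Lemma deriv_peval_at (u : 'I_4 -> {poly K}) F (p : K * K) x :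
  (forall i, (u i).[x] = nu p.1 p.2 i) ->
  (peval u F)^`().[x] = grad F p 0 * (u (inord 0))^`().[x]
   + grad F p 1 * (u (inord 1))^`().[x] + grad F p 2 * (u (inord 2))^`().[x]
   + grad F p 3 * (u (inord 3))^`().[x].
Proof.
move=> hu; rewrite deriv_peval sum4 !hornerD !hornerM.
have E i : (peval u F^`M(inord i)).[x] = grad F p i.
  by rewrite horner_peval; apply: meval_eq.
by rewrite !E.
Qed.

(** The [s]-derivative of the trace is the derivative of [F] along the ruling of constant [t], whose
    direction is [(0, 1, 0, t)]. *)
Lemma pull_derivl F (p : K * K) :
  (pull F)^`().[p.1%:P].[p.2] = grad F p 1 + grad F p 3 * p.2.
Proof.
pose f := horner_eval p.2.
have E : map_poly f (pull F) = peval (nu 'X p.2%:P) F.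
  apply: rmorph_mmap => [a|i] /=.
    by rewrite map_polyC /= /f /horner_eval hornerC.
  have fX : f 'X = p.2 by rewrite /f /horner_eval hornerX.
  rewrite /nu; case: i => [[|[|[|[|//]]]] lt] /=.
  - by rewrite rmorph1.
  - by rewrite map_polyX.
  - by rewrite map_polyC; congr _%:P; exact: fX.
  - by rewrite rmorphM /= map_polyX map_polyC; congr (_ * _%:P); exact: fX.
have -> : (pull F)^`().[p.1%:P].[p.2] = (map_poly f (pull F)^`()).[f p.1%:P].
  by rewrite horner_map.
rewrite -deriv_map E {1}/f /horner_eval hornerC (@deriv_peval_at _ _ p).
  rewrite /nu !inordK //= derivM !derivC derivX !(hornerM, hornerD, hornerC, hornerX).
  ring.
by move=> i; rewrite nu_horner hornerX hornerC.
Qed.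

Lemma pull_derivr F (p : K * K) :
  ((pull F).[p.1%:P])^`().[p.2] = grad F p 2 + grad F p 3 * p.1.
Proof.
have E : (pull F).[p.1%:P] = peval (nu p.1%:P 'X) F.
  rewrite -/(horner_eval _ _); apply: rmorph_mmap => [a|i] /=.
    by rewrite /horner_eval hornerC.
  rewrite /nu; case: i => [[|[|[|[|//]]]] lt] /=;
  by rewrite /horner_eval ?hornerM ?hornerC ?hornerX.
rewrite E (@deriv_peval_at _ _ p).
  rewrite /nu !inordK //= derivM !derivC derivX !(hornerM, hornerD, hornerC, hornerX).
  ring.
by move=> i; rewrite nu_horner hornerX hornerC.
Qed.

Lemma grad_chord (p q : K * K) F : vanish_chord p q F ->
  grad F p 0 + grad F p 1 * q.1 + grad F p 2 * q.2 + grad F p 3 * (q.1 * q.2) = 0.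
Proof.
move=> h; pose u i : {poly K} := (nu p.1 p.2 i)%:P + 'X * (nu q.1 q.2 i)%:P.
have u0 : peval u F = 0.
  apply: (poly_eq0_fun charK0) => t; rewrite horner_peval -(h 1 t); apply: meval_eq => i.
  by rewrite /u /chord hornerD hornerM !hornerC hornerX mul1r.
have := @deriv_peval_at u F p 0; rewrite u0 deriv0 horner0 => -> //.
  rewrite /u !(derivD, derivM, derivC, derivX) /nu !inordK //=.
  by rewrite !(hornerM, hornerD, hornerC, hornerX); ring.
by move=> i; rewrite /u hornerD hornerM hornerX mul0r addr0 hornerC.
Qed.

(** The Euler relation at a zero of [F], obtained from the degenerate chord joining [p] to
    itself. *)
Lemma grad_self (p q : K * K) F : vanish_chord p q F ->
  grad F p 0 + grad F p 1 * p.1 + grad F p 2 * p.2 + grad F p 3 * (p.1 * p.2) = 0.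
Proof.
move=> h; apply: grad_chord => a b; rewrite -(h (a + b) 0); apply: meval_eq => i.
by rewrite /chord; ring.
Qed.

(* The gradient is orthogonal to the plane of the two chords through [p], and to
   the first ruling direction, which is not in that plane. *)
Lemma double_of_chords (p q v : K * K) F :
  vanish_chord p q F -> vanish_chord p v F ->
  q.2 <> p.2 -> v.2 <> p.2 -> q.1 <> v.1 ->
  grad F p 1 + grad F p 3 * p.2 = 0 -> double_at (pull F) p.
Proof.
move=> hq hv /eqP q2 /eqP v2 /eqP qv es; split.
- by rewrite pull_eval; exact: vanish_left hq.
- by rewrite pull_derivl.
rewrite pull_derivr; have := grad_self hq; have := grad_chord hq; have := grad_chord hv.
have -> : grad F p 1 = - (grad F p 3 * p.2) by apply/eqP; rewrite -addr_eq0 es.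
set g0 := grad F p 0; set g2 := grad F p 2; set g3 := grad F p 3 => ev eq ep.
(* With the first gradient entry eliminated, subtracting the relation at [p] from that at [q] leaves
   a product. The two resulting equations, for [q] and [v], force [g3] and [g2] to vanish. *)
have e1 : (q.2 - p.2) * (g2 + g3 * q.1) = 0.
  transitivity ((g0 + - (g3 * p.2) * q.1 + g2 * q.2 + g3 * (q.1 * q.2)) -
    (g0 + - (g3 * p.2) * p.1 + g2 * p.2 + g3 * (p.1 * p.2))); first ring.
  by rewrite eq ep subr0.
have e2 : (v.2 - p.2) * (g2 + g3 * v.1) = 0.
  transitivity ((g0 + - (g3 * p.2) * v.1 + g2 * v.2 + g3 * (v.1 * v.2)) -
    (g0 + - (g3 * p.2) * p.1 + g2 * p.2 + g3 * (p.1 * p.2))); first ring.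
  by rewrite ev ep subr0.
move/eqP: e1; rewrite mulf_eq0 subr_eq0 (negPf q2) /= => /eqP e1.
move/eqP: e2; rewrite mulf_eq0 subr_eq0 (negPf v2) /= => /eqP e2.
have : (q.1 - v.1) * g3 = 0.
  by transitivity ((g2 + g3 * q.1) - (g2 + g3 * v.1)); [ring|rewrite e1 e2 subrr].
move/eqP; rewrite mulf_eq0 subr_eq0 (negPf qv) /= => /eqP g30.
by move: e1; rewrite g30 !mul0r.
Qed.

(** Hermite interpolation with double nodes [r1] and simple nodes [r2], by dividing out one squared
    linear factor at a time. *)
Lemma hermite_eq0 (p : {poly K}) (r1 r2 : seq K) :
  (size p <= 2 * size r1 + size r2)%N -> uniq (r1 ++ r2) ->
  (forall x, x \in r1 ++ r2 -> p.[x] = 0) -> (forall x, x \in r1 -> p^`().[x] = 0) ->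
  p = 0.
Proof.
elim: r1 p => [|a r1 IH] p /= sp.
  by move=> u h _; apply: roots_eq0 sp u h.
case/andP=> ar ur h h'.
have /factor_theorem[q qE] : root p a by rewrite /root h ?mem_head.
have /factor_theorem[w wE] : root q a.
  rewrite /root; have := h' a (mem_head _ _).
  by rewrite qE derivM derivXsubC hornerD !hornerM hornerXsubC subrr mulr0 add0r hornerC mulr1 => ->.
have pE : p = w * ('X - a%:P) ^+ 2 by rewrite qE wE -mulrA.
suff w0 : w = 0 by rewrite pE w0 mul0r.
have xa x : x \in r1 ++ r2 -> x - a != 0.
  by move=> xr; rewrite subr_eq0; apply: contraNneq ar => <-.
have w1 x : x \in r1 ++ r2 -> w.[x] = 0.
  move=> xr; have := h x; rewrite inE xr orbT => /(_ isT).
  rewrite pE hornerM horner_exp hornerXsubC => /eqP.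
  by rewrite mulf_eq0 expf_eq0 (negPf (xa x xr)) orbF => /eqP.
apply: IH => //.
  have [->|nz] := eqVneq w 0; first by rewrite size_poly0.
  move: sp; rewrite pE size_Mmonic ?monic_exp ?monicXsubC // size_exp_XsubC; lia.
move=> x xr; have xr' : x \in r1 ++ r2 by rewrite mem_cat xr.
have := h' x; rewrite inE xr orbT => /(_ isT).
rewrite pE derivM hornerD !hornerM (w1 _ xr') mul0r addr0.
rewrite hornerXsubC => /eqP.
by rewrite !mulf_eq0 (negPf (xa x xr')) !orbF => /eqP.
Qed.

(** Unlike on a grid, the abscissae may change with [b]: each slice [t = b] is zero, so every
    coefficient in [s] has [B] roots. *)
Lemma columns_eq0 A B (g : {poly {poly K}}) : bideg A B g ->
  (forall b, (b < B)%N -> exists rs : seq K,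
     [/\ (A <= size rs)%N, uniq rs & forall s, s \in rs -> g.[s%:P].[b%:R] = 0]) ->
  g = 0.
Proof.
move=> [sA sB] h; apply/polyP => i; rewrite coef0.
apply: (@roots_eq0 _ _ [seq b%:R | b <- iota 0 B]).
- by rewrite size_map size_iota.
- by rewrite map_inj_uniq ?iota_uniq //; exact: natr_inj.
move=> y /mapP[b]; rewrite mem_iota => /andP[_ ltb] ->.
have [rs [lers urs hrs]] := h b ltb.
have z : map_poly (horner_eval (b%:R : K)) g = 0.
  apply: (@roots_eq0 _ _ rs) => //.
    by apply: leq_trans (size_poly _ _) _; apply: leq_trans lers.
  move=> s /hrs <-.
  have -> : s = horner_eval (b%:R : K) s%:P by rewrite /horner_eval hornerC.
  by rewrite horner_map /= /horner_eval hornerC.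
have := congr1 (fun p : {poly K} => p`_i) z.
by rewrite coef0 coef_map.
Qed.

End Crossing.

(** * Explicit unisolvent arrangements with double points *)

Section DoublePoints.
Variable K : fieldType.
Hypothesis charK0 : [pchar K] =i pred0.

Lemma natr_pts_mem (s1 s2 : seq nat) (a b : nat) :
  a \in s1 -> b \in s2 ->
  ((a%:R, b%:R) : K * K) \in [seq (i%:R, j%:R) | i <- s1, j <- s2].
Proof.
by move=> ha hb; apply/allpairsP; exists (a, b).
Qed.

Lemma unisolvent_pts A B n M (dbl : nat -> K * K) (pts : seq (K * K)) :
  (n + size pts = M)%N ->
  (forall g, bideg A B g -> (forall p, p \in pts -> g.[p.1%:P].[p.2] = 0) ->
     (forall i, (i < n)%N -> double_at g (dbl i)) -> g = 0) ->
  exists c, unisolvent A B (fun i j => i = j /\ (n <= i < M)%N) (fun i => (i < n)%N)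
    (c : cfg K).
Proof.
move=> sz h; exists (fun i => if (i < n)%N then dbl i else nth (0, 0) pts (i - n)).
move=> g bg hS hD; apply: h => // [p /(nthP (0, 0))[i lti <-]|i lti].
  have ni : (n + i < n)%N = false by lia.
  have := hS (n + i)%N (n + i)%N; rewrite ni addKn; apply; split=> //.
  by rewrite leq_addr -sz ltn_add2l.
by have := hD i lti; rewrite lti.
Qed.

(** The case [k = 1], too small for splitting off two rulings: both double points lie on [s = 0],
    which is split off alone. *)
Lemma double_unisolvent1 : exists c, unisolvent 2 5
  (fun i j => i = j /\ (2 <= i < 6)%N) (fun i => (i < 2)%N) (c : cfg K).
Proof.
pose pts : seq (K * K) := (0, 2%:R) :: [seq (1, i%:R) | i <- iota 2 3].
apply: (@unisolvent_pts 2 5 2 6 (fun i => (0, i%:R)) pts) => // g bg hS hD.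
have g0 : g.[0%:P] = 0.
  apply: (@hermite_eq0 K _ [seq i%:R | i <- iota 0 2] [seq i%:R | i <- iota 2 1]).
  - exact: size_horner_bideg bg.
  - by rewrite -map_cat map_inj_uniq //; exact: natr_inj.
  - move=> x; rewrite -map_cat => /mapP[i]; rewrite /= !inE => /or3P[] /eqP -> ->.
    + by have [] := hD 0%N isT.
    + by have [] := hD 1%N isT.
    + by apply: (hS (0, 2%:R)); rewrite mem_head.
  - move=> x /mapP[i]; rewrite mem_iota => /andP[_ lti] ->.
    by have [_ _] := hD i lti.
have [|||w bw wE] := @factor_rulings K 1 5 [:: 0] g.
- exact: bg.
- by [].
- by move=> s; rewrite inE => /eqP ->.
suff w0 : w = 0 by rewrite wE w0 mul0r.
apply: (columns_eq0 charK0 bw) => b ltb.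
have [lt2|ge2] := ltnP b 2.
  exists [:: 0]; split=> // s; rewrite inE => /eqP ->.
  apply: (@factor_deriv K [:: 0]) => //; rewrite ?mem_head // -wE.
  by have [_ ? _] := hD b lt2.
exists [:: 1]; split=> // s; rewrite inE => /eqP ->.
apply: (@factor_simple K [:: 0]); first by rewrite inE oner_eq0.
rewrite -wE; apply: (hS (1, b%:R)); rewrite inE; apply/orP; right.
by apply/mapP; exists b => //; rewrite mem_iota; lia.
Qed.

(* There are [k] double and [k + 2] simple points on each of the rulings [s = 0]
   and [s = 1]; splitting these rulings off turns the double points into simple
   points with distinct second coordinates. *)
Lemma double_unisolvent2 k : (2 <= k)%N -> exists c, unisolvent k.+1 (3 * k + 2)
  (fun i j => i = j /\ (2 * k <= i < 3 * k * k + k + 2)%N) (fun i => (i < 2 * k)%N)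
  (c : cfg K).
Proof.
move=> k2.
pose pts : seq (K * K) :=
  [seq (i%:R, j%:R) | i <- iota 0 k.+1, j <- iota (2 * k) (k + 2)] ++
  [seq (i%:R, j%:R) | i <- iota 2 (k - 2), j <- iota 0 (2 * k)].
(* Double point [i] has second coordinate [i]; the first [k] of them lie on [s = 0], the others on
   [s = 1]. *)
apply: (@unisolvent_pts _ _ _ _ (fun i => ((k <= i)%N%:R, i%:R)) pts).
  rewrite size_cat !size_allpairs !size_iota.
  have [m ->] : exists m, k = m.+2 by exists (k - 2)%N; lia.
  nia.
move=> g bg hS hD.
have hS1 a b : (a <= k)%N -> (2 * k <= b < 3 * k + 2)%N -> g.[(a%:R : K)%:P].[b%:R] = 0.
  move=> la lb; apply: (hS (a%:R, b%:R)); rewrite mem_cat; apply/orP; left.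
  by apply: natr_pts_mem => //; rewrite mem_iota; lia.
have hS2 a b : (2 <= a < k)%N -> (b < 2 * k)%N -> g.[(a%:R : K)%:P].[b%:R] = 0.
  move=> la lb; apply: (hS (a%:R, b%:R)); rewrite mem_cat; apply/orP; right.
  by apply: natr_pts_mem => //; rewrite mem_iota; lia.
have hD' (o : bool) i : (k * o <= i < k * o + k)%N -> double_at g (o%:R, i%:R).
  move=> hi; have := hD i; rewrite (_ : (k <= i)%N = o); last by case: o hi => /=; lia.
  by apply; case: o hi => /=; lia.
have g0 (o : bool) : g.[(o%:R : K)%:P] = 0.
  apply: (@hermite_eq0 K _ [seq i%:R | i <- iota (k * o) k]
            [seq i%:R | i <- iota (2 * k) (k + 2)]).
  - by rewrite !size_map !size_iota; apply: leq_trans (size_horner_bideg _ bg) _; lia.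
  - rewrite -map_cat map_inj_uniq; last exact: natr_inj.
    rewrite cat_uniq !iota_uniq /= andbT; apply/hasPn => x; rewrite !mem_iota.
    by case: o => /=; lia.
  - move=> x; rewrite mem_cat => /orP[] /mapP[i]; rewrite mem_iota => hi ->.
      by have [] := hD' o i hi.
    by apply: (@hS1 o); lia.
  - move=> x /mapP[i]; rewrite mem_iota => hi ->.
    by have [] := hD' o i hi.
have urs : uniq [:: 0; 1 : K] by rewrite /= inE eq_sym oner_eq0.
have [|||w bw wE] := @factor_rulings K k.-1 (3 * k + 2) [:: 0; 1] g.
- by rewrite (_ : (_ + k.-1)%N = k.+1) //=; lia.
- exact: urs.
- by move=> s; rewrite !inE => /orP[] /eqP ->; [apply: (g0 false)|apply: (g0 true)].
suff w0 : w = 0 by rewrite wE w0 mul0r.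
have wS a b : (2 <= a)%N -> g.[(a%:R : K)%:P].[b%:R] = 0 -> w.[(a%:R : K)%:P].[b%:R] = 0.
  move=> la; rewrite wE; apply: factor_simple; rewrite !inE negb_or.
  apply/andP; split.
    by apply/eqP => /(@natr_inj _ charK0 a 0); lia.
  by apply/eqP => /(@natr_inj _ charK0 a 1); lia.
have wD (o : bool) b : (k * o <= b < k * o + k)%N -> w.[(o%:R : K)%:P].[b%:R] = 0.
  move=> hb; apply: (@factor_deriv K [:: 0; 1] _ _ _ urs).
    by case: o {hb}; rewrite !inE eqxx ?orbT.
  by rewrite -wE; have [] := hD' o b hb.
apply: (columns_eq0 charK0 bw) => b ltb.
(* Each slice needs [k - 1] zeros: for [b < 2 k], one former double point and [k - 2] simple points;
   otherwise, the simple points with [s] from 2 to [k]. *)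
have [ltk|gek] := ltnP b (2 * k).
  pose o := (k <= b)%N.
  exists [seq (i%:R : K) | i <- (o : nat) :: iota 2 (k - 2)]; split.
  - by rewrite size_map /= size_iota; lia.
  - rewrite map_inj_uniq; last exact: natr_inj.
    rewrite /= iota_uniq andbT mem_iota; case: (o) => /=; lia.
  move=> s /mapP[i]; rewrite inE => /orP[/eqP -> ->|].
    by apply: wD; rewrite /o; case: (leqP k b) => /=; lia.
  rewrite mem_iota => hi ->; apply: wS; first lia.
  by apply: hS2; lia.
exists [seq (i%:R : K) | i <- iota 2 k.-1]; split.
- by rewrite size_map size_iota.
- by rewrite map_inj_uniq ?iota_uniq //; exact: natr_inj.
move=> s /mapP[i]; rewrite mem_iota => hi ->; apply: wS; first lia.
by apply: hS1; lia.
Qed.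

End DoublePoints.

(** * The two-step reduction in degrees [3 k + 1] *)

Section CrossingStep.
Variable K : fieldType.
Hypothesis charK0 : [pchar K] =i pred0.

Lemma double_unisolvent k : (1 <= k)%N -> exists c, unisolvent k.+1 (3 * k + 2)
  (fun i j => i = j /\ (2 * k <= i < 3 * k * k + k + 2)%N) (fun i => (i < 2 * k)%N)
  (c : cfg K).
Proof.
case: k => [//|[|k]] _; last exact: double_unisolvent2.
exact: double_unisolvent1.
Qed.

(** The new degree is four more than the old: [mid_exists] handles the lower step, and the limit of
    the moving chords handles the upper one, where the conditions from double and simple points add
    up to [(k1 + 1) * (3 * k1 + 2)]. *)
Lemma has_spanning_double_step k r : (2 * r = 3 * k * k.+1)%N ->
  has_spanning K (3 * k) (k.+1 + r) ->
  has_spanning K (3 * k.+1 + 1) (5 * k.+1 + r + 2).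
Proof.
move=> cnt hs; have [c0 hc0] := mid_exists charK0 cnt hs.
set k1 := k.+1; set r1 := r.+1; pose n := (k1 + r1)%N.
have [c1 hc1] := @double_unisolvent k1 isT.
pose M := (2 * n + 2 * k1)%N.
have ME : (3 * k1 * k1 + k1 + 2 = M)%N by rewrite /M /n /k1 /r1; nia.
rewrite ME in hc1.
have o1 := @zopen_lines K (3 * k + 2) (mid_rel k1 r1).
have o2 := @zopen_unisolvent K k1.+1 (3 * k1 + 2)
  (fun i j => i = j /\ (2 * k1 <= i < M)%N) (fun i => (i < 2 * k1)%N).
have [c' [h1 h2]] := zopen_meet charK0 o1 o2 hc0 hc1.
have [c [[hc uc] dc]] := zopen_meet charK0 (zopen_and o1 o2)
  (@zopen_distinct K M) (conj h1 h2) (@distinct_natr K charK0 M).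
have [rs [srs urs frs]] :=
  exists_fresh charK0 (2 * k1).+1 [seq (c i).1 | i <- iota 0 M].
have nrs i : (i < M)%N -> (c i).1 \notin rs.
  move=> lei; apply/negP => /frs/negP; apply; apply/mapP; exists i => //.
  by rewrite mem_iota.
pose moved t j : K * K := ((c j).1 + t, (c j).2).
pose L t := standard_lines n c ++
  mkseq (fun j => (moved t j, c (2 * n + j)%N)) (2 * k1) ++ ruling_lines rs.
set d := (3 * k1 + 1)%N.
have [|t ht] := @kernel_limit K charK0 (dhomog 4 K d)
  (fun t F => forall l, l \in L t -> vanish_chord l.1 l.2 F); last first.
  exists (L t).
    by rewrite !size_cat !size_mkseq size_map srs /n /k1 /r1; lia.
  by move=> F hF h; have /(congr1 val) := ht (DHomog hF) h.
move=> F hlim; apply/val_inj => /=; set F' := (F : {mpoly K[4]}).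
have hF : F' \is d.-homog by exact: dhomog_is_dhomog.
have fixed l : (forall t, l \in L t) -> vanish_chord l.1 l.2 F'.
  move=> hl a b; pose u i : {poly K} := (chord l.1 l.2 a b i)%:P.
  have E (G : dhomog 4 K d) t : (peval u G).[t] = (G : {mpoly K[4]}).@[chord l.1 l.2 a b].
    by rewrite horner_peval; apply: meval_eq => i; rewrite hornerC.
  rewrite -(E F 0); apply: (hlim (fun G : dhomog 4 K d => peval u G)).
    by move=> x G H; rewrite -peval_linear.
  by move=> t G _ TG; rewrite E; apply: TG.
pose mv (j : nat) : 'I_4 -> {poly K} := nu ((c j).1%:P + 'X) (c j).2%:P.
have mvE j t i : (mv j i).[t] = nu (moved t j).1 (moved t j).2 i.
  by rewrite nu_horner hornerD !hornerC hornerX.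
have movedL t j : (j < 2 * k1)%N -> (moved t j, c (2 * n + j)%N) \in L t.
  move=> ltj; rewrite !mem_cat; apply/orP; right; apply/orP; left.
  by apply/mapP; exists j => //; rewrite mem_iota.
have moving j : (j < 2 * k1)%N -> vanish_chord (c j) (c (2 * n + j)%N) F'.
  move=> ltj a b; set q := c (2 * n + j)%N.
  pose u i : {poly K} := a%:P * mv j i + (b * nu q.1 q.2 i)%:P.
  have E (G : dhomog 4 K d) t :
      (peval u G).[t] = (G : {mpoly K[4]}).@[chord (moved t j) q a b].
    rewrite horner_peval; apply: meval_eq => i.
    by rewrite hornerD hornerM !hornerC mvE.
  have -> : c j = moved 0 j by rewrite /moved addr0; case: (c j).
  rewrite -(E F 0); apply: (hlim (fun G : dhomog 4 K d => peval u G)).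
    by move=> x G H; rewrite -peval_linear.
  by move=> t G _ TG; rewrite E; apply: (TG (moved t j, q)); apply: movedL.
have std i j : standard n i j -> vanish_chord (c i) (c j) F'.
  by apply: vanish_standard_lines => l hl; apply: fixed => t; rewrite mem_cat hl.
have stdL t i j : standard n i j -> (c i, c j) \in L t.
  move=> [m ltm [-> ->]]; rewrite mem_cat; apply/orP; left.
  by apply/mapP; exists m => //; rewrite mem_iota.
have partner j : (j < 2 * n)%N -> exists2 j', (j' < 2 * n)%N /\ j' != j &
    standard n j j' \/ standard n j' j.
  move=> ltj; have jE := odd_double_half j.
  have st : standard n (2 * j./2)%N (2 * j./2).+1 by exists j./2 => //; lia.
  case: (odd j) jE => jE.
    exists (2 * j./2)%N; first by split; lia.
    by right; rewrite {2}(_ : j = (2 * j./2).+1) //; lia.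
  exists (2 * j./2).+1; first by split; lia.
  by left; rewrite {1}(_ : j = (2 * j./2)%N) //; lia.
have k1n : (2 * k1 <= 2 * n)%N by rewrite /n; lia.
(* A form [G] for [t != 0] vanishes at [c j], on a standard chord, and at [moved t j]. Its
   difference quotient along the ruling, given by [drop_poly 1], thus vanishes at [t]; at [t = 0]
   that quotient is the derivative. *)
have slope j : (j < 2 * k1)%N -> grad F' (c j) 1 + grad F' (c j) 3 * (c j).2 = 0.
  move=> ltj.
  have E : (peval (mv j) F')^`().[0] = grad F' (c j) 1 + grad F' (c j) 3 * (c j).2.
    rewrite (@deriv_peval_at _ _ _ (c j)); last first.
      by move=> i; rewrite mvE /moved addr0.
    rewrite /mv /nu !inordK //= derivM !derivD !derivC derivX.
    by rewrite !(hornerM, hornerD, hornerC, hornerX); ring.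
  rewrite -E.
  have -> : (peval (mv j) F')^`().[0] = (drop_poly 1 (peval (mv j) F')).[0].
    by rewrite !horner_coef0 coef_deriv coef_drop_poly.
  apply: (hlim (fun G : dhomog 4 K d => drop_poly 1 (peval (mv j) G))).
    by move=> x G H; rewrite /= -drop_polyZ -drop_polyD -peval_linear.
  move=> t G nzt TG; set p := peval (mv j) _.
  have p0 : p.[0] = 0.
    rewrite /p horner_peval.
    have -> : (G : {mpoly K[4]}).@[fun i => (mv j i).[0]] =
        (G : {mpoly K[4]}).@[nu (c j).1 (c j).2].
      by apply: meval_eq => i; rewrite mvE /moved addr0.
    have [j' _ [st|st]] := partner j (leq_trans ltj k1n).
      exact: vanish_left (TG _ (stdL t _ _ st)).
    exact: vanish_right (TG _ (stdL t _ _ st)).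
  have pt : p.[t] = 0.
    rewrite /p horner_peval -(vanish_left (TG _ (movedL t j ltj))).
    by apply: meval_eq => i; rewrite mvE.
  have pE : p = drop_poly 1 p * 'X.
    rewrite -{1}[p](poly_take_drop 1) expr1 (_ : take_poly 1 p = 0) ?add0r //.
    apply/polyP => i; rewrite coef_take_poly coef0; case: ltnP => // lti.
    by move: p0; rewrite horner_coef0; case: i lti.
  move: pt; rewrite {1}pE hornerM hornerX => /eqP.
  by rewrite mulf_eq0 (negPf nzt) orbF => /eqP.
have dbl j : (j < 2 * k1)%N -> double_at (pull F') (c j).
  move=> ltj; have [j' [ltj' jj'] st] := partner j (leq_trans ltj k1n).
  have M1 : (j < M)%N by rewrite /M; lia.
  have M2 : (j' < M)%N by rewrite /M; lia.
  have M3 : (2 * n + j < M)%N by rewrite /M; lia.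
  have [_ n1] := dc _ M2 _ M1 jj'.
  have [_ n2] : (c (2 * n + j)%N).1 <> (c j).1 /\ (c (2 * n + j)%N).2 <> (c j).2.
    by apply: dc => //; lia.
  have [n3 _] : (c j').1 <> (c (2 * n + j)%N).1 /\ (c j').2 <> (c (2 * n + j)%N).2.
    by apply: dc => //; lia.
  apply: (@double_of_chords _ charK0 _ (c j') (c (2 * n + j)%N)) => //.
  - by case: st => st; [|apply: vanish_chord_sym]; exact: std.
  - exact: moving.
  - exact: slope.
have [|||G hG FE] := castelnuovo charK0 (A := k1.+1) hF _ urs.
- by rewrite srs /d; lia.
- apply: vanish_ruling_lines => // l hl; apply: fixed => t.
  by rewrite !mem_cat hl !orbT.
- move=> g; rewrite (_ : d.+1 = 3 * k1 + 2)%N; last by rewrite /d; lia.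
  move=> bg gE; apply: uc => // [i j [<- /andP[lei lti]]|i lti].
    apply: (@factor_simple _ rs); first exact: nrs.
    rewrite -gE pull_eval.
    have [lt2|ge2] := ltnP i (2 * n).
      have [j' _ [st|st]] := partner i lt2.
        exact: vanish_left (std _ _ st).
      exact: vanish_right (std _ _ st).
    have -> : i = (2 * n + (i - 2 * n))%N by lia.
    by apply: vanish_right (moving _ _); move: lti; rewrite /M; lia.
  by apply: (@factor_double _ rs); [apply: nrs; rewrite /M; lia|rewrite -gE; exact: dbl].
(* Dividing by the quadric loses the double points: [G] is only known to vanish on the standard and
   crossing chords, which is what [hc] asks for. *)
suff G0 : G = 0 by rewrite FE G0 mulr0.
apply: hc; first by move: hG; rewrite (_ : d - 2 = 3 * k + 2)%N // /d /k1; lia.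
move=> i j [st|[ltj ->]].
  have dn : distinct (2 * n) c.
    by move=> x ltx y lty xy; apply: dc => //; rewrite /M; lia.
  by apply: (residual_standard charK0 dn) st => x y st; rewrite -FE; exact: std.
have [n1 n2] : (c i).1 <> (c (2 * n + i)%N).1 /\ (c i).2 <> (c (2 * n + i)%N).2.
  by apply: dc; rewrite /M; lia.
by apply: vanish_residual => //; rewrite -FE; exact: moving.
Qed.

End CrossingStep.

(** * General configurations *)

Lemma double_lines k e : (2 * (((3 * k + 5 + 2 * e) * k)./2 + 1 + e) =
  (3 * k + 5 + 2 * e) * k + 2 + 2 * e)%N.
Proof.
have ev : ~~ odd ((3 * k + 5 + 2 * e) * k)%N.
  rewrite oddM oddD [odd (2 * e)%N]oddM oddD [odd (3 * k)%N]oddM /=.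
  by case: (odd k).
by have := odd_double_half ((3 * k + 5 + 2 * e) * k)%N; rewrite (negPf ev); lia.
Qed.

(** The equality of dimensions of the two sides of the restriction map, checked after multiplication
    by [3!]. *)
Lemma count_conditions k e : (e <= 2)%N ->
  'C(3 * k + e + 3, 3 * k + e) =
  ((((3 * k + 5 + 2 * e) * k)./2 + 1 + e) * (3 * k + e).+1 + (k + 1) * (e == 2))%N.
Proof.
move=> e2; have := double_lines k e; set l := (_ + 1 + e)%N => lE.
apply/eqP; rewrite -(eqn_pmul2r (isT : 0 < 3`!)%N); apply/eqP.
rewrite -bin_sub ?leq_addr // addKn bin_ffact !ffactnS ffactn0 muln1.
rewrite (_ : _.-1 = 3 * k + e + 2)%N; last lia.
rewrite (_ : _.-1 = 3 * k + e + 1)%N; last lia.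
have -> : ((l * (3 * k + e).+1 + (k + 1) * (e == 2)) * 3`! =
  3 * (2 * l) * (3 * k + e).+1 + 6 * (k + 1) * (e == 2))%N by rewrite !factS fact0; lia.
rewrite lE; case: e e2 {l lE} => [|[|[|//]]] _ /=; lia.
Qed.

Section Main.
Variable K : fieldType.
Hypothesis charK0 : [pchar K] =i pred0.

Lemma has_spanning_deg0 : has_spanning K 0 1.
Proof.
exists [:: ((0, 0), (0, 0))] => // F hF h.
have FE : F = (F@_0)%:MP.
  apply/mpolyP => m; rewrite mcoeffC; have [<-|nz] := eqVneq 0%MM m; first by rewrite mulr1.
  by rewrite mulr0 (dhomog_nemf_coeff hF) //= mdeg_eq0 eq_sym.
have := h _ (mem_head _ _) 0 0; rewrite {1}FE mevalC => F0.
by rewrite FE F0 mpolyC0.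
Qed.

Lemma has_spanning_deg1 : has_spanning K 1 2.
Proof.
exists (ruling_lines [:: 0; 1]) => // F hF h.
have [||||G hG FE] := castelnuovo charK0 (A := 0) (rs := [:: 0; 1]) hF.
- by [].
- by rewrite /= inE eq_sym oner_eq0.
- exact: vanish_ruling_lines h.
- by move=> g [sg _] _; apply/eqP; rewrite -size_poly_leq0.
(* Here [1 - 2] truncates to 0, so [quad K * G] has degree 2 while [F] has degree 1; a nonzero [F]
   cannot have both. *)
apply/eqP/negPn/negP => nz; have := dhomogM (quad_homog K) hG.
by rewrite -FE => /(dhomog_uniq nz hF).
Qed.

(** Both families are carried by one induction: degree [3 (k + 1)] comes from [3 k + 1] in one step,
    and [3 (k + 1) + 1] from [3 k] in two. *)
Lemma spanning_lines k :
  (forall n, (2 * n = (3 * k + 5) * k + 2)%N -> has_spanning K (3 * k) n) /\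
  (forall n, (2 * n = (3 * k + 7) * k + 4)%N -> has_spanning K (3 * k + 1) n).
Proof.
elim: k => [|k [IH0 IH1]]; split=> n nE.
- by rewrite (_ : n = 1%N); [exact: has_spanning_deg0|lia].
- by rewrite (_ : n = 2%N); [exact: has_spanning_deg1|lia].
- have hn : has_spanning K (3 * k + 1) (n - (2 * k + 3)) by apply: IH1; nia.
  have := @horace_lines K charK0 _ _ (2 * k + 3) k.+1 hn.
  rewrite (_ : 3 * k + 1 + 2 = 3 * k.+1)%N; last lia.
  rewrite (_ : n - (2 * k + 3) + (2 * k + 3) = n)%N; last nia.
  by apply; nia.
pose r := (n - (5 * k.+1 + 2))%N.
have rE : (2 * r = 3 * k * k.+1)%N by rewrite /r; nia.
rewrite (_ : n = 5 * k.+1 + r + 2)%N; last by rewrite /r; nia.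
apply: has_spanning_double_step => //; apply: IH0.
by move: rE; lia.
Qed.

Lemma spanning_lines_points k e : (e <= 2)%N ->
  let l := (((3 * k + 5 + 2 * e) * k)./2 + 1 + e)%N in
  let p := ((k + 1) * (e == 2))%N in
  exists (L : seq ((K * K) * (K * K))) s0 ts, [/\ size L = l, size ts = p &
    forall F, F \is (3 * k + e).-homog ->
      (forall q, q \in L -> vanish_chord q.1 q.2 F) ->
      (forall t, t \in ts -> F.@[nu s0 t] = 0) -> F = 0].
Proof.
move=> e2 l p.
have lE : (2 * l = (3 * k + 5 + 2 * e) * k + 2 + 2 * e)%N := double_lines k e.
have [h0 h1] := spanning_lines k.
case: e @p e2 l lE => [|[|[|//]]] p _ l lE.
- have [L sL hL] : has_spanning K (3 * k) l by apply: h0; lia.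
  exists L, 0, [::]; split=> //; first by rewrite /p muln0.
  by rewrite addn0 => F hF h _; apply: hL.
- have [L sL hL] : has_spanning K (3 * k + 1) l by apply: h1; nia.
  exists L, 0, [::]; split=> //; first by rewrite /p muln0.
  by move=> F hF h _; apply: hL.
have hn : has_spanning K (3 * k) (l - (2 * k + 2)) by apply: h0; nia.
have [|||L [s0 [ts [sL sts hL]]]] := @horace_points K charK0 _ _ (2 * k + 2) k.+1 k.+1 hn.
- nia.
- lia.
- lia.
exists L, s0, ts; split=> //; first by rewrite sL; nia.
by rewrite sts /p muln1 addn1.
Qed.

(** * From one injective configuration to general bijective ones *)

Lemma binary_form_eq0 d (h : {mpoly K[2]}) : h \is d.-homog ->
  (forall b, (b <= d)%N -> h.@[fun i : 'I_2 => if i == 0 then 1 else b%:R] = 0) -> h = 0.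
Proof.
move=> hh h0; pose u (i : 'I_2) : {poly K} := if i == 0 then 1 else 'X.
have mdeg2 (m : 'X_{1..2}) : mdeg m = (m 0%R + m 1%R)%N.
  rewrite mdegE !big_ord_recl big_ord0 addn0.
  by congr (m _ + m _)%N; apply/val_inj.
have cE j : (peval u h)`_j = \sum_(m <- msupp h) h@_m * (j == m 1%R)%N%:R.
  rewrite /peval /mmap coef_sum; apply: eq_bigr => m _.
  rewrite /mmap1 !big_ord_recl big_ord0 /u /= expr1n mul1r mulr1 coefCM coefXn.
  by congr (_ * (j == m _)%:R); apply/val_inj.
have z : peval u h = 0.
  apply: (@roots_eq0 _ _ [seq b%:R | b <- iota 0 d.+1]).
  - rewrite size_map size_iota; apply/leq_sizeP => j lej; rewrite cE big_seq big1 //.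
    move=> m /(dhomog_mf hh) /=; rewrite mdeg2 => hm.
    by rewrite (_ : (j == m 1%R)%N = false) ?mulr0 //; lia.
  - by rewrite map_inj_uniq ?iota_uniq //; exact: natr_inj.
  move=> x /mapP[b]; rewrite mem_iota => /andP[_ ltb] ->.
  rewrite horner_peval -[RHS](h0 b) //; apply: meval_eq => i.
  by rewrite /u; case: ifP => _; rewrite ?hornerC ?hornerX.
apply/mpolyP => m; rewrite mcoeff0.
have [hm|] := boolP (m \in msupp h); last exact: memN_msupp_eq0.
have := cE (m 1); rewrite z coef0 (bigD1_seq m) //= eqxx mulr1 big_seq_cond big1 ?addr0 //.
move=> m' /andP[/(dhomog_mf hh) /=]; rewrite mdeg2 => d' mm'.
have := dhomog_mf hh hm; rewrite /= mdeg2 => dm.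
have [e1|_] := eqVneq (m 1) (m' 1); last by rewrite mulr0.
case/eqP: mm'; apply/mnmP => -[[|[|//]] lt].
  by rewrite (_ : Ordinal lt = 0) //; [lia|apply/val_inj].
by rewrite (_ : Ordinal lt = 1) //; apply/val_inj.
Qed.

Lemma restr_line_homog d (u v : 'I_4 -> K) F : F \is d.-homog -> restr_line u v F \is d.-homog.
Proof.
move=> hF; rewrite /restr_line comp_mpolyEX big_seq rpred_sum // => m /(dhomog_mf hF) /= md.
rewrite rpredZ // comp_mpolyX -md mdegE.
elim/big_rec2: _ => [|i x y _ hx]; first exact: dhomog1.
apply: dhomogM hx; rewrite -[X in X.-homog]mul1n; apply: dhomogMn.
have lin (j : 'I_2) (a : K) : 'X_j * a%:MP \is 1.-homog.
  by rewrite mulrC mul_mpolyC rpredZ // dhomogX /= mdeg1.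
by rewrite tnth_mktuple rpredD.
Qed.

Lemma meval_restr_line (u v : 'I_4 -> K) F (w : 'I_2 -> K) :
  (restr_line u v F).@[w] = F.@[fun i => w 0 * u i + w 1 * v i].
Proof.
rewrite /restr_line comp_mpoly_meval; apply: meval_eq => i.
by rewrite tnth_mktuple mevalD !mevalM !mevalXU !mevalC.
Qed.

Lemma restr_line_eq0 d (u v : 'I_4 -> K) F : F \is d.-homog ->
  (forall b, (b <= d)%N -> F.@[fun i => u i + b%:R * v i] = 0) -> restr_line u v F = 0.
Proof.
move=> hF h; apply: (binary_form_eq0 (restr_line_homog u v hF)) => b leb.
rewrite meval_restr_line -[RHS](h b leb); apply: meval_eq => i.
by rewrite /= mul1r.
Qed.

(** A binary form of degree [d] is known from [d + 1] values, so the restriction map is replaced by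
    finitely many evaluations. *)
Definition sample_index d l p : finType := (('I_l * 'I_d.+1) + 'I_p)%type.

Definition sample_vec (R : comNzRingType) d l p (y : cfg_index l p -> R)
    (j : sample_index d l p) : 'I_4 -> R :=
  match j with
  | inl (i, b) => fun c => y (inl (inl (i, 0, c))) + b%:R * y (inl (inl (i, 1, c)))
  | inr j => fun c => y (inr (j, 0)) * y (inl (inr (0, c))) +
                      y (inr (j, 1)) * y (inl (inr (1, c)))
  end.

(** Injectivity at [x0] makes the sampling matrix row free on a nonempty open set; the dimension
    count makes it square, so it is invertible there. *)
Lemma general_of_injective d l p (x0 : cfg_index l p -> K) :
  'C(d + 3, d) = (l * d.+1 + p)%N ->
  (forall F, F \is d.-homog ->
     (forall j : sample_index d l p, F.@[sample_vec x0 j] = 0) -> F = 0) ->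
  general_cfg (fun x : cfg_index l p -> K => restriction_bijective x d).
Proof.
move=> dimE inj0; pose V := dhomog 4 K d; pose N := dim V; pose J := sample_index d l p.
have NE : N = #|J| by rewrite card_sum card_prod !card_ord -dimE.
pose n := #|cfg_index l p|; pose R := {mpoly K[n]}.
pose X (i : cfg_index l p) : R := 'X_(enum_rank i).
pose b (i : 'I_N) : V := @r2v K V (delta_mx 0 i).
(* The sampling matrix with the parameters of the configuration as indeterminates, so that one
   polynomial serves all configurations. *)
pose A : 'M[R]_(N, #|J|) :=
  \matrix_(i, j) mmap (@mpolyC n K) (sample_vec X (enum_val j)) (b i : {mpoly K[4]}).
pose pr (x : cfg_index l p -> K) : 'I_n -> K := fun i => x (enum_val i).
have AE x (F : V) j : (v2r F *m map_mx (meval (pr x)) A) 0 j =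
    (F : {mpoly K[4]}).@[sample_vec x (enum_val j)].
  have FE : F = \sum_i v2r F 0 i *: b i.
    rewrite -{1}[F]v2rK {1}(row_sum_delta (v2r F)) linear_sum /=.
    by apply: eq_bigr => i _; rewrite linearZ.
  rewrite [in RHS]FE (linear_sum (@mpoly_of_dhomog 4 K d)) /= raddf_sum /= mxE.
  apply: eq_bigr => i _.
  rewrite linearZ /= !mxE; congr (_ * _).
  apply: rmorph_mmap => [a|c] /=; first exact: mevalC.
  rewrite /sample_vec; case: (enum_val j) => [[i' b']|j'];
    by rewrite mevalD !mevalM ?rmorph_nat ?mevalXU /X /pr ?enum_rankK.
have [||Q nzQ HQ] := @row_free_open K R ('I_n -> K) (@mpolyC n K) (@meval n K) _ _ _ A (pr x0).
- by move=> x a /=; rewrite mevalC.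
- rewrite -kermx_eq0; apply/rowV0P => v /sub_kermxP vA.
  have F0 : @r2v K V v = 0.
    apply/val_inj; apply: inj0; first exact: dhomog_is_dhomog.
    move=> j; have := AE x0 (@r2v K V v) (enum_rank j).
    by rewrite enum_rankK r2vK => <-; rewrite vA mxE.
  by rewrite -[v](@r2vK K V) F0 linear0.
exists Q; split.
  by apply: contraNneq nzQ => ->; rewrite /= meval0.
move=> x /HQ fA g c hg.
have : row_full (map_mx (meval (pr x)) A) by rewrite /row_full (eqP fA) NE.
case/row_fullP => B BA.
pose pt2 (b : nat) : 'I_2 -> K := fun i => if i == 0 then 1 else b%:R.
pose ys (s : J) : K := match s with
  | inl (i, b) => (g i).@[pt2 b] | inr j => c j end.
pose y : 'rV[K]_#|J| := \row_j ys (enum_val j).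
(* Prescribing the samples is the same as prescribing the restrictions, since two binary forms of
   degree [d] agreeing at [d + 1] samples coincide. *)
have goodP (F : {mpoly K[4]}) (hF : F \is d.-homog) :
    (v2r (DHomog hF : V) *m map_mx (meval (pr x)) A = y) <->
    (forall i, restr_line (line_vec x i 0) (line_vec x i 1) F = g i) /\
    (forall j, F.@[pt x j] = c j).
  split=> [E|[h1 h2]].
    split=> [i|j].
      apply/eqP; rewrite -subr_eq0; apply/eqP.
      apply: (@binary_form_eq0 d); first by apply: rpredB; [exact: restr_line_homog|exact: hg].
      move=> b' leb; rewrite mevalB meval_restr_line /=.
      have := AE x (DHomog hF) (enum_rank (inl (i, inord b') : J)).
      rewrite E mxE enum_rankK /ys /= inordK // => ->.
      apply/eqP; rewrite subr_eq0; apply/eqP; apply: meval_eq => c'.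
      by rewrite /= mul1r.
    have := AE x (DHomog hF) (enum_rank (inr j : J)).
    by rewrite E mxE enum_rankK /ys => ->.
  apply/matrixP => i j; rewrite ord1 AE mxE /ys; case: (enum_val j) => [[i' b']|j'] /=.
    rewrite -h1 meval_restr_line; apply: meval_eq => c'.
    by rewrite /pt2 /= mul1r.
  exact: h2.
pose F := @r2v K V (y *m B).
have hF : (F : {mpoly K[4]}) \is d.-homog by exact: dhomog_is_dhomog.
have FE : F = DHomog hF by apply/val_inj.
exists (F : {mpoly K[4]}); split.
  have [|h1 h2] := proj1 (goodP _ hF); last by [].
  by rewrite -FE r2vK -mulmxA BA mulmx1.
move=> F' [hF' h1 h2].
have E' := proj2 (goodP _ hF') (conj h1 h2).
have E : v2r F *m map_mx (meval (pr x)) A = y by rewrite r2vK -mulmxA BA mulmx1.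
have : v2r F = v2r (DHomog hF' : V).
  by apply: (row_free_inj fA); rewrite E E'.
by move/(can_inj v2rK) => ->.
Qed.

End Main.

Theorem theorem2p2 (K : closedFieldType) (charK0 : [pchar K]%R =i pred0)
    (k e : nat) (he : (e <= 2)%N) (hd : (1 <= 3 * k + e)%N) :
  let d := (3 * k + e)%N in
  let l := (((3 * k + 5 + 2 * e) * k)./2 + 1 + e)%N in
  let p := ((k + 1) * (e == 2))%N in
  general_cfg (fun x : cfg_index l p -> K => restriction_bijective x d).
Proof.
move=> d l p.
have [L [s0 [ts [sL sts hL]]]] := spanning_lines_points charK0 k he.
pose z : (K * K) * (K * K) := ((0, 0), (0, 0)).
(* [L0] is the ruling [s = s0], spanned by [(1, s0, 0, 0)] and [(0, 0, 1, s0)]; the coordinates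
   [[1 : t]] on it give the point [nu s0 t]. *)
pose x0 (i : cfg_index l p) : K := match i with
  | inl (inl (i, j, c)) => let q := nth z L i in
      if j == 0 then nu q.1.1 q.1.2 c else nu q.2.1 q.2.2 c
  | inl (inr (j, c)) => if j == 0 then [:: 1; s0; 0; 0]`_c else [:: 0; 0; 1; s0]`_c
  | inr (j, b) => if b == 0 then 1 else nth 0 ts j end.
apply: (@general_of_injective K charK0 d l p x0).
  exact: count_conditions.
move=> F hF h; apply: hL => // [q /(nthP z)[i lti <-] a b|t /(nthP 0)[i lti <-]].
  rewrite sL in lti; set q' := nth z L i.
  have E := @restr_line_eq0 K charK0 d (nu q'.1.1 q'.1.2) (nu q'.2.1 q'.2.2) F hF.
  pose w (i : 'I_2) := if i == 0 then a else b.
  have := meval_restr_line (nu q'.1.1 q'.1.2) (nu q'.2.1 q'.2.2) F w.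
  rewrite E ?meval0; first by move=> ->; apply: meval_eq.
  move=> b' leb; rewrite -(h (inl (Ordinal lti, inord b'))); apply: meval_eq => c.
  by rewrite /= inordK.
rewrite sts in lti; rewrite -[RHS](h (inr (Ordinal lti))); apply: meval_eq => c.
rewrite /= mul1r /nu; case: c => [[|[|[|[|//]]]] lt] /=; ring.
Qed.
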